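(* Suppose $M$ is a function on $\Sigma_A$ taking values in the set of all $d\times d$ non-negative matrices such that: (H1) there are matrices $M_1,\dots,M_m$ with $M(x)=M_i$ whenever $x\in[i]$, $i=1,\dots,m$; (H2) there exists an integer $r>0$ such that for any $i,j\in\{1,\dots,m\}$, $$\sum_{k=1}^r\ \sum_{K\in\Sigma_{A,k;i,j}}M_K>\mathbf{0}$$ (all entries strictly positive). Then for any $q>0$ there is a unique $\sigma$-invariant, ergodic probability measure $\mu_q$ on $\Sigma_A$ for which one can find constants $C_1>0$, $C_2>0$ such that $$C_1\exp(-nP(q))\,\|M_J\|^q\ \le\ \mu_q([J])\ \le\ C_2\exp(-nP(q))\,\|M_J\|^q$$ for any $n>0$ and $J\in\Sigma_{A,n}$.
   Context: Let $m\ge 2$, $\Sigma=\{1,\dots,m\}^{\mathbb{N}}$, with the left shift $\sigma$ and the metric $d(x,y)=m^{-n}$ for $x\neq y$, where $n$ is the smallest $k$ with $x_k\ne y_k$. Let $A$ be an $m\times m$ matrix with entries $0$ or $1$, assumed primitive (some power $A^p$ has all entries strictly positive). $\Sigma_A=\{x\in\Sigma: A_{x_k,x_{k+1}}=1\ \text{for all } k\}$ is the associated subshift of finite type. $\Sigma_{A,n}$ is the set of admissible words $J=j_1\cdots j_n$ of length $n$ over $\{1,\dots,m\}$ (that is, $A_{j_k,j_{k+1}}=1$ for $1\le k<n$), and $[J]=\{x\in\Sigma_A: x_i=j_i,\ 1\le i\le n\}$ is the cylinder set. $\Sigma_{A,k;i,j}$ is the set of all $K\in\Sigma_{A,k}$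 such that the concatenation $iKj$ lies in $\Sigma_{A,k+2}$. For a word $J=j_1\cdots j_n$, $M_J=M_{j_1}\cdots M_{j_n}$. The matrix norm is $\|B\|=\mathbf{1}^tB\mathbf{1}$ with $\mathbf{1}^t=(1,\dots,1)$ (the sum of all entries). The pressure function, for $q>0$, is $$P(q)=\lim_{n\to\infty}\frac1n\log\sum_{J\in\Sigma_{A,n}}\|M_J\|^q,$$ the limit existing in this setting. *)

(* Defs.v *)
From HB Require Import structures.
From mathcomp Require Import all_boot all_order all_algebra.
From mathcomp Require Import all_classical all_reals all_analysis.

Set Implicit Arguments.
Unset Strict Implicit.
Unset Printing Implicit Defensive.

Import Order.TTheory GRing.Theory Num.Theory.
Import numFieldNormedType.Exports.

Local Open Scope classical_set_scope.
Local Open Scope ring_scope.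

(* The alphabet {1, ..., m} is 'I_m and the sequence x_1 x_2 ... is
   x : nat -> 'I_m with x_k = x k.-1. *)

Definition zero_one_mx (m : nat) (A : 'M[nat]_m) : Prop :=
  forall i j, A i j = 0%N \/ A i j = 1%N.

Definition primitive_mx (m : nat) (A : 'M[nat]_m) : Prop :=
  exists2 p : nat, (0 < p)%N & forall i j, (0 < (A ^+ p) i j)%N.

Definition allowed (m : nat) (A : 'M[nat]_m) : rel 'I_m :=
  fun i j => A i j == 1%N.

Definition SigmaA (m : nat) (A : 'M[nat]_m) : set (nat -> 'I_m) :=
  [set x | forall k, allowed A (x k) (x k.+1)].

Lemma SigmaA_neq0 (m : nat) (A : 'M[nat]_m) :
  (1 < m)%N -> zero_one_mx A -> primitive_mx A -> SigmaA A !=set0.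
Proof.
move=> m1 A01 [[//|p] _ Ap].
have next i : exists j, allowed A i j.
  apply: contrapT => /forallNP noj.
  have := Ap i i; rewrite exprS mxE big1 // => j _.
  case: (A01 i j) => [->|Aij]; first by rewrite mul0r.
  by case: (noj j); rewrite /allowed Aij.
have [f Hf] := choice next.
by exists (fun k => iter k f (Ordinal (ltnW m1))) => k /=; exact: Hf.
Qed.

Definition shift_dist (R : realType) (m : nat) (x y : nat -> 'I_m) : R :=
  if pselect (exists k, x k != y k) is left xy then m%:R ^- (ex_minn xy).+1
  else 0.

(* [R] is a phantom parameter: the distance is R-valued.  The proof [A0] of
   nonemptiness is carried because measurable types must be pointed. *)
Definition sft (R : realType) (m : nat) (A : 'M[nat]_m)
  (A0 : SigmaA A !=set0) : Type := set_type (SigmaA A).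

Section sft_metric.
Context (R : realType) (m : nat) (A : 'M[nat]_m) (A0 : SigmaA A !=set0).
Local Notation S := (sft R A0).

Definition sft_seq (x : S) : nat -> 'I_m := sval x.

HB.instance Definition _ := Choice.copy S (set_type (SigmaA A)).

Let S_point : S := SigSub (mem_set (svalP (cid A0))).

HB.instance Definition _ := isPointed.Build S S_point.

Definition sft_dist (x y : S) : R := shift_dist R (sft_seq x) (sft_seq y).

Variant shift_dist_spec (x y : nat -> 'I_m) : R -> Type :=
| ShiftDistEq of x = y : shift_dist_spec x y 0
| ShiftDistNeq n of x n != y n & (forall k, (k < n)%N -> x k = y k)
    & (1 < m)%N : shift_dist_spec x y (m%:R ^- n.+1).

Lemma shift_distP (x y : nat -> 'I_m) :
  shift_dist_spec x y (shift_dist R x y).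
Proof.
rewrite /shift_dist; case: pselect => [xy|xy].
  case: ex_minnP => n xyn nmin; apply: ShiftDistNeq => //.
    move=> k kn; apply/eqP; apply: contraTT kn => /nmin.
    by rewrite -leqNgt.
  rewrite ltnNge; apply: contra xyn => m_le1; apply/eqP/val_inj.
  have small (i : 'I_m) : val i = 0%N.
    by apply/eqP; rewrite -leqn0 -ltnS (leq_trans (ltn_ord i)).
  by rewrite !small.
apply: ShiftDistEq; apply/funext => k; apply/eqP.
by apply: contrapT => /negP xyk; apply: xy; exists k.
Qed.

Let sft_dist_ge0 x y : 0 <= sft_dist x y.
Proof.
by rewrite /sft_dist; case: shift_distP => *; rewrite ?invr_ge0 ?exprn_ge0.
Qed.

Let sft_dist_eq0 x y : sft_dist x y = 0 -> x = y.
Proof.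
rewrite /sft_dist; case: shift_distP => [xy _|n _ _ m1].
  exact/val_inj.
by move/eqP; rewrite invr_eq0 expf_eq0 /= pnatr_eq0 gtn_eqF // ltnW.
Qed.

Let sft_distxx x : sft_dist x x = 0.
Proof. by rewrite /sft_dist; case: shift_distP => // n; rewrite eqxx. Qed.

Let sft_dist_sym x y : sft_dist x y = sft_dist y x.
Proof.
rewrite /sft_dist; case: shift_distP => [->|n xyn xyk _].
  by case: shift_distP => // n; rewrite eqxx.
case: shift_distP => [yx|k yxk yxn _]; first by rewrite yx eqxx in xyn.
case: (ltngtP n k) => [/yxn e|/xyk e|-> //].
  by rewrite e eqxx in xyn.
by rewrite e eqxx in yxk.
Qed.

Let sft_dist_triangle y x z : sft_dist x z <= sft_dist x y + sft_dist y z.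
Proof.
have := sft_dist_ge0 x y; have := sft_dist_ge0 y z.
rewrite /sft_dist.
case: (shift_distP (sft_seq x) (sft_seq z)) => [_|n xzn xzk m1].
  by move=> ? ?; rewrite addr_ge0.
have m0 : 0 < m%:R :> R by rewrite ltr0n (ltnW m1).
have mono k : (k <= n)%N -> m%:R ^- n.+1 <= m%:R ^- k.+1 :> R.
  move=> kn; rewrite lef_pV2 ?posrE ?exprn_gt0 //.
  by apply: ler_weXn2l; rewrite // ler1n (ltnW m1).
case: (shift_distP (sft_seq x) (sft_seq y)) => [xy|k xyk xyl _].
  case: shift_distP => [yz|l yzl yzj _ _ _].
    by move: xzn; rewrite xy yz eqxx.
  rewrite add0r mono // leqNgt; apply/negP => /yzj.
  by rewrite -xy => /eqP; apply/negP.
move=> yz0 _; have [kn|nk] := leqP k n.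
  by rewrite (le_trans (mono _ kn)) // lerDl.
case: shift_distP => [yz|l yzl yzj _].
  by move: xzn; rewrite (xyl _ nk) yz eqxx.
rewrite (le_trans (mono l _)) ?lerDr ?invr_ge0 ?exprn_ge0 // leqNgt.
apply/negP => /yzj; rewrite -(xyl _ nk) => /eqP; exact/negP.
Qed.

HB.instance Definition _ := @isMetric.Build R S sft_dist
  sft_distxx sft_dist_eq0 sft_dist_sym sft_dist_triangle.

(* A copy of Sigma_A with its Borel sigma-algebra. *)
Definition borel_sft := g_sigma_algebraType (@open S).

Let shift_subproof (x : S) : (fun k => sft_seq x k.+1) \in SigmaA A.
Proof. by rewrite inE => k; have := svalP x; rewrite inE; exact. Qed.

Definition sft_shift (x : S) : S := SigSub (shift_subproof x).

Definition cylinder (n : nat) (J : n.-tuple 'I_m) : set S :=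
  [set x | forall i : 'I_n, sft_seq x i = tnth J i].

Definition shift_invariant (mu : probability borel_sft R) : Prop :=
  forall B : set borel_sft, measurable B -> mu (sft_shift @^-1` B) = mu B.

Definition shift_ergodic (mu : probability borel_sft R) : Prop :=
  forall B : set borel_sft, measurable B -> sft_shift @^-1` B = B ->
    mu B = 0%E \/ mu B = 1%E.

End sft_metric.

Definition words (m : nat) (A : 'M[nat]_m) (n : nat) : {set n.-tuple 'I_m} :=
  [set J : n.-tuple 'I_m | sorted (allowed A) J]%SET.

Definition link_words (m : nat) (A : 'M[nat]_m) (k : nat) (i j : 'I_m) :
    {set k.-tuple 'I_m} :=
  [set K in words A k | [tuple of i :: rcons K j] \in words A k.+2]%SET.

Definition word_mx (R : realType) (m d : nat) (Mi : 'I_m -> 'M[R]_d)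
    (J : seq 'I_m) : 'M[R]_d :=
  \big[mulmx/1%:M]_(j <- J) Mi j.

Definition sum_norm (R : realType) (d : nat) (B : 'M[R]_d) : R :=
  ((const_mx 1 : 'rV_d) *m B *m (const_mx 1 : 'cV_d)) 0 0.

Definition pressure (R : realType) (m d : nat) (A : 'M[nat]_m)
    (Mi : 'I_m -> 'M[R]_d) (q : R) : R :=
  limn (fun n : nat =>
    n%:R^-1 * ln (\sum_(J in words A n) sum_norm (word_mx Mi J) `^ q)).

Definition gibbs_bounds (R : realType) (m d : nat) (A : 'M[nat]_m)
    (A0 : SigmaA A !=set0) (Mi : 'I_m -> 'M[R]_d) (q : R)
    (mu : probability (borel_sft R A0) R) : Prop :=
  exists C1 C2 : R, [/\ 0 < C1, 0 < C2 &
    forall (n : nat) (J : n.-tuple 'I_m), (0 < n)%N -> J \in words A n ->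
      let g :=
        expR (- (n%:R * pressure A Mi q)) * sum_norm (word_mx Mi J) `^ q in
      ((C1 * g)%:E <= mu (cylinder J) <= (C2 * g)%:E)%E].

(* Two measures are identified when they agree on measurable sets: a library
   measure is a function on all sets, with unconstrained values outside the
   sigma-algebra, so Leibniz uniqueness would be false. *)
Definition exists_unique_measure (disp : measure_display)
    (T : measurableType disp) (R : realType)
    (P : probability T R -> Prop) : Prop :=
  exists mu : probability T R, P mu /\
    forall nu : probability T R, P nu ->
      forall B : set T, measurable B -> nu B = mu B.

(* Main.v *)
From HB Require Import structures.
Require Import Defs.
From mathcomp Require Import all_boot all_order all_algebra.
From mathcomp Require Import all_classical all_reals all_analysis.
From mathcomp Require Import ring lra zify.

Set Implicit Arguments.
Unset Strict Implicit.
Unset Printing Implicit Defensive.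

Import Order.TTheory GRing.Theory Num.Theory.
Import numFieldNormedType.Exports.

Local Open Scope classical_set_scope.
Local Open Scope ring_scope.

(** The word weights [w J = ||M_J||^q], extended by zero to inadmissible words,
    behave like a multiplicative function up to connecting words: they are
    submultiplicative, and by positivity of the sums in the second hypothesis
    [c w(I) w(J)] is at most the sum of [w(I K J)] over the words [K] of length
    between [1] and [r]. Everything about the Gibbs measure follows from these
    two inequalities; the matrices only return at the end, in
    [matrix_weight_quasi_multiplicative].

    Growth. Let [Z n] be the total weight of the words of length [n]. Cutting a
    connecting word off again costs a bounded factor, so [Z (n + k)] and [Z n *
    Z k] are comparable, [ln (Z n)] is almost additive, and [Z n] agrees with
    [exp (n P)] up to a constant ([partition_sum_growth]). In the same way the
    weight of all words that carry [J] between blocks of lengths [i] and [k] is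
    comparable to [Z i * w J * Z k] ([context_sum_le], [context_sum_ge]).

    Existence. Average over the positions [i < N] the weighted proportion,
    among all words of length [2 N], of those that carry [J] at position [i].
    For [N] large this frequency is comparable to [exp (- |J| P) w J], and it
    is invariant under the shift up to an error [1 / N]. Its limit along an
    ultrafilter is an exactly consistent and shift-invariant assignment of
    masses to words ([invariant_gibbs_weights]). Such an assignment is realised
    by a Borel measure ([cylinder_extension]): nested half-open intervals of
    the prescribed lengths code the points of an interval by sequences, and
    Lebesgue measure is pushed forward along the coding.

    The extension result also yields the comparison principle
    [cylinder_comparison]: if [mu <= nu] on cylinders then the differences [nu
    - mu] of cylinder masses are themselves the masses of a measure, whence [mu
    <= nu] on all Borel sets.

    Ergodicity. The Gibbs bounds turn the second inequality for [w] into [c'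
    mu[I] mu[J] <= sum_l mu([I] /\ shift^-(|I|+l) [J])]. By comparison [J] may
    be replaced by any Borel set; for an invariant set [C] this gives [c' mu(I)
    mu(C) <= r mu(I /\ C)], first for cylinders [I], then for all Borel sets,
    and in particular for the complement of [C] ([quasi_bernoulli_ergodic]).

    Uniqueness. Two Gibbs measures have the same null sets, again by
    comparison. If [P] is a positive set of a Hahn decomposition of [nu - mu],
    then the part of [nu - mu] on [P] is carried by the set [C] of the points
    whose whole orbit stays in [P]. Since [C] is contained in its preimage, it
    has measure zero or one, and in both cases [nu - mu] has constant sign;
    both having mass one, [nu = mu] ([invariant_probability_unique]). *)

(** * Sums over words *)

Section word_sums.
Context (V : nmodType) (T : finType).
Implicit Types (F : seq T -> V) (n k : nat).

Lemma big_tuple0 F : \sum_(s : 0.-tuple T) F s = F [::].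
Proof.
rewrite (big_pred1 ([tuple] : 0.-tuple T)) // => s.
by apply/esym/eqP; exact: tuple0.
Qed.

Lemma big_tupleS n F :
  \sum_(s : n.+1.-tuple T) F s = \sum_(i : T) \sum_(s : n.-tuple T) F (i :: s).
Proof.
rewrite pair_big (reindex (fun p : T * n.-tuple T => [tuple of p.1 :: p.2])).
  exact: eq_bigr.
exists (fun s : n.+1.-tuple T => (thead s, [tuple of behead s])).
  by move=> [i s] _ /=; rewrite theadE; congr pair; exact/val_inj.
by move=> s _ /=; rewrite -tuple_eta.
Qed.

Lemma big_tuple1 F : \sum_(s : 1.-tuple T) F s = \sum_(i : T) F [:: i].
Proof.
rewrite big_tupleS; apply: eq_bigr => i _.
exact: (big_tuple0 (fun s => F (i :: s))).
Qed.

Lemma big_tuple_cat n k F : \sum_(s : (n + k).-tuple T) F s =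
  \sum_(s : n.-tuple T) \sum_(t : k.-tuple T) F (s ++ t).
Proof.
elim: n F => [|n IHn] F.
  by rewrite add0n (big_tuple0 (fun s => \sum_t F (s ++ tval t))).
rewrite (big_tupleS _ F) (big_tupleS _ (fun s => \sum_t F (s ++ tval t))).
by apply: eq_bigr => i _; rewrite (IHn (fun s => F (i :: s))).
Qed.

Lemma big_tuple_catC n k F : \sum_(s : (n + k).-tuple T) F s =
  \sum_(s : k.-tuple T) \sum_(t : n.-tuple T) F (s ++ t).
Proof. by rewrite addnC big_tuple_cat. Qed.

End word_sums.

(** * Quasi-multiplicative weights *)

Section quasi_multiplicative_weights.
Context (R : realType) (T : finType) (w : seq T -> R) (r : nat) (c : R).

Definition connected_sum (s t : seq T) : R :=
  \sum_(1 <= l < r.+1) \sum_(u : l.-tuple T) w (s ++ u ++ t).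

(** The connecting words are needed for the empty word as well, so that the
    boundary terms of the estimates below need no separate treatment. *)
Definition quasi_multiplicative : Prop :=
  [/\ forall s, 0 <= w s, 0 < w [::], forall s t, w (s ++ t) <= w s * w t,
   0 < c & forall s t, c * (w s * w t) <= connected_sum s t].

Definition partition_sum n := \sum_(s : n.-tuple T) w s.
Definition link_mass := \sum_(1 <= l < r.+1) partition_sum l.

Local Notation Z := partition_sum.
Local Notation D := link_mass.

(** Extending on the right gives consistency of the limit masses, extending on
    the left their invariance under the shift. *)
Definition context_sum i s k :=
  \sum_(t : i.-tuple T) \sum_(u : k.-tuple T) w (t ++ s ++ u).

Lemma context_sum_rcons i s k :
  context_sum i s k.+1 = \sum_(j : T) context_sum i (rcons s j) k.
Proof.
rewrite /context_sum [RHS]exchange_big /=; apply: eq_bigr => t _.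
rewrite (big_tupleS _ (fun u => w (t ++ s ++ u))); apply: eq_bigr => j _.
by apply: eq_bigr => u _; rewrite cat_rcons.
Qed.

Lemma context_sum_cons i s k :
  context_sum i.+1 s k = \sum_(j : T) context_sum i (j :: s) k.
Proof.
rewrite /context_sum -addn1.
rewrite (big_tuple_cat _ _ (fun t => \sum_u w (t ++ s ++ tval u))).
rewrite [RHS]exchange_big /=; apply: eq_bigr => t _.
rewrite (big_tuple1 (fun j => \sum_(u : k.-tuple T) w ((t ++ j) ++ s ++ u))).
by apply: eq_bigr => j _; apply: eq_bigr => u _; rewrite -catA.
Qed.

Context (wqm : quasi_multiplicative).
Let w_ge0 s : 0 <= w s. Proof. by case: wqm. Qed.
Let w_nil : 0 < w [::]. Proof. by case: wqm. Qed.
Let w_sub s t : w (s ++ t) <= w s * w t. Proof. by case: wqm. Qed.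
Let c_gt0 : 0 < c. Proof. by case: wqm. Qed.
Let w_super s t : c * (w s * w t) <= connected_sum s t.
Proof. by case: wqm. Qed.

Lemma partition_sum_ge0 n : 0 <= Z n. Proof. exact: sumr_ge0. Qed.

Lemma partition_sum0 : Z 0 = w [::]. Proof. exact: big_tuple0. Qed.

Lemma partition_sumD n k : Z (n + k) <= Z n * Z k.
Proof.
rewrite /Z big_tuple_cat mulr_suml; apply: ler_sum => s _.
by rewrite mulr_sumr; apply: ler_sum.
Qed.

Lemma link_mass_gt0 : 0 < D.
Proof.
apply: lt_le_trans (_ : c * (w [::] * w [::]) <= _); first by rewrite !mulr_gt0.
apply: le_trans (w_super _ _) _; rewrite le_eqVlt; apply/orP; left; apply/eqP.
by apply: eq_bigr => l _; apply: eq_bigr => u _; rewrite cats0.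
Qed.

(** Connecting [s] to [u] by a word of length [l] gives an [s] followed by a
    word of length [k + l]; forgetting its last [l] letters costs at most [Z l]
    by submultiplicativity, hence at most [D] in total. *)
Lemma context_sum_right s k :
  c * (w s * Z k) <= D * \sum_(u : k.-tuple T) w (s ++ u).
Proof.
rewrite mulrA mulr_sumr.
apply: le_trans (_ : \sum_(u : k.-tuple T) connected_sum s u <= _).
  by apply: ler_sum => u _; rewrite -mulrA.
rewrite /connected_sum exchange_big /= mulr_suml; apply: ler_sum => l _.
rewrite exchange_big /= -(big_tuple_cat l k (fun u => w (s ++ u))).
rewrite (big_tuple_catC l k (fun u => w (s ++ u))) mulrC mulr_suml.
apply: ler_sum => u _; rewrite mulr_sumr; apply: ler_sum => v _.
by rewrite catA.
Qed.

Lemma context_sum_left s i :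
  c * (Z i * w s) <= D * \sum_(t : i.-tuple T) w (t ++ s).
Proof.
rewrite mulrA mulrAC mulr_sumr.
apply: le_trans (_ : \sum_(t : i.-tuple T) connected_sum t s <= _).
  by apply: ler_sum => t _; rewrite mulrAC -mulrA.
rewrite /connected_sum exchange_big /= mulr_suml; apply: ler_sum => l _.
under eq_bigr do under eq_bigr do rewrite catA.
rewrite -(big_tuple_cat i l (fun u => w (u ++ s))).
rewrite (big_tuple_catC i l (fun u => w (u ++ s))) mulr_suml.
apply: ler_sum => u _; rewrite mulr_sumr; apply: ler_sum => v _.
by rewrite -catA.
Qed.

Lemma partition_sum_super n k : c * (Z n * Z k) <= D * Z (n + k).
Proof.
rewrite /(Z (n + k)) big_tuple_cat mulr_suml !mulr_sumr.
by apply: ler_sum => s _; exact: context_sum_right.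
Qed.

(** Some [Z l] with [0 < l] is positive since [D] is, which forces [Z 1] to be
    positive; supermultiplicativity then propagates this to all lengths. *)
Lemma partition_sum_gt0 n : 0 < Z n.
Proof.
have [l l0 Zl] : exists2 l, (0 < l)%N & 0 < Z l.
  apply: contrapT => nol; move: link_mass_gt0; rewrite /D big_nat_cond big1 ?ltxx//.
  move=> l /andP[/andP[l0 _] _]; apply/eqP; rewrite eq_le partition_sum_ge0 andbT.
  by rewrite leNgt; apply/negP => Zl; apply: nol; exists l.
have Z1 : 0 < Z 1.
  have := lt_le_trans Zl; case: l l0 {Zl} => // l _.
  move=> /(_ _ (partition_sumD 1 l)); apply: contraTT; rewrite -!leNgt => Z1.
  by rewrite mulr_le0_ge0 ?partition_sum_ge0.
elim: n => [|n IHn]; first by rewrite partition_sum0.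
have h : 0 < D * Z n.+1.
  rewrite -addn1; apply: lt_le_trans (partition_sum_super n 1).
  by rewrite !mulr_gt0.
by move: h; rewrite (pmulr_rgt0 _ link_mass_gt0).
Qed.

Lemma context_sum_le i s k : context_sum i s k <= Z i * w s * Z k.
Proof.
rewrite /context_sum /Z !mulr_suml; apply: ler_sum => t _; rewrite mulr_sumr.
apply: ler_sum => u _; rewrite -mulrA; apply: le_trans (w_sub _ _) _.
by rewrite ler_wpM2l.
Qed.

(** One factor [c / D] for attaching the [k] letters on the right, another one
    for attaching the [i] letters on the left. *)
Lemma context_sum_ge i s k :
  (c / D) ^+ 2 * (Z i * w s * Z k) <= context_sum i s k.
Proof.
have D0 := link_mass_gt0.
have cD x y : (c / D * x <= y) = (c * x <= D * y).
  by rewrite mulrAC ler_pdivrMr // [y * D]mulrC.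
rewrite expr2 -[c / D * _ * _]mulrA -[Z i * _ * _]mulrA cD.
apply: le_trans (_ : c * (Z i * \sum_(u : k.-tuple T) w (s ++ u)) <= _).
  rewrite ler_pM2l // mulrCA ler_wpM2l ?partition_sum_ge0 // cD.
  exact: context_sum_right.
rewrite /context_sum exchange_big /= !mulr_sumr; apply: ler_sum => u _.
exact: context_sum_left.
Qed.

Lemma context_sum_le_partition i s k :
  context_sum i s k <= Z (i + size s + k).
Proof.
rewrite /Z -addnA big_tuple_cat; apply: ler_sum => t _.
rewrite (big_tuple_cat _ _ (fun v => w (t ++ v))).
(* the words that carry [s] at position [i] are among all words *)
rewrite (bigD1 (in_tuple s)) //= lerDl; apply: sumr_ge0 => v _.
exact: sumr_ge0.
Qed.

Lemma context_sum_ge0 i s k : 0 <= context_sum i s k.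
Proof. by apply: sumr_ge0 => t _; exact: sumr_ge0. Qed.

End quasi_multiplicative_weights.

(** The inequality for nonempty words extends to empty ones: insert a letter
    [a] of positive weight in place of the empty word, and divide by [w [:: a]]
    after splitting it off by submultiplicativity. *)
Lemma quasi_multiplicative_nonempty (R : realType) (T : finType) (w : seq T -> R)
    (r : nat) (c : R) :
  (forall s, 0 <= w s) -> 0 < w [::] -> (forall s t, w (s ++ t) <= w s * w t) ->
  0 < c -> (exists a, 0 < w [:: a]) ->
  (forall s t, (0 < size s)%N -> (0 < size t)%N ->
    c * (w s * w t) <= connected_sum w r s t) ->
  exists c', quasi_multiplicative w r c'.
Proof.
move=> w_ge0 w_nil w_sub c0 [a wa] w_super.
pose v s := if s is [::] then 1 else w s.
have v_ge0 s : 0 <= v s by case: s => [|x s] //=.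
have wv s : w s <= (1 + w [::]) * v s.
  case: s => [|x s] /=; first by rewrite mulr1 lerDr.
  by rewrite mulrDl mul1r lerDl mulr_ge0 // ltW.
have conn_ge0 s t : 0 <= connected_sum w r s t.
  by apply: sumr_ge0 => l _; exact: sumr_ge0.
have v_right s t : (0 < size s)%N -> c * (w s * v t) <= connected_sum w r s t.
  move=> s0; case: t => [|x t]; last exact: w_super.
  rewrite /= mulr1 -(ler_pM2r wa) -mulrA; apply: le_trans (w_super s [:: a] s0 isT) _.
  rewrite /connected_sum mulr_suml; apply: ler_sum => l _.
  by rewrite mulr_suml; apply: ler_sum => u _; rewrite cats0 catA.
have v_super s t : c * (v s * v t) <= connected_sum w r s t.
  case: s => [|x s]; last exact: v_right.
  rewrite /= mul1r -(ler_pM2l wa) mulrCA; apply: le_trans (v_right [:: a] t isT) _.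
  rewrite /connected_sum mulr_sumr; apply: ler_sum => l _.
  by rewrite mulr_sumr; apply: ler_sum => u _.
(* [w s <= (1 + w [::]) * v s] is used for each of the two words *)
have w1 : 0 < 1 + w [::] by rewrite ltr_wpDl.
exists (c / (1 + w [::]) ^+ 2); split => //; first by rewrite divr_gt0 // exprn_gt0.
move=> s t; rewrite mulrAC ler_pdivrMr ?exprn_gt0 //.
apply: le_trans (_ : c * (((1 + w [::]) * v s) * ((1 + w [::]) * v t)) <= _).
  by rewrite ler_pM2l //; apply: ler_pM.
have -> : c * (((1 + w [::]) * v s) * ((1 + w [::]) * v t)) =
  c * (v s * v t) * (1 + w [::]) ^+ 2 by ring.
by rewrite ler_pM2r ?exprn_gt0.
Qed.

(** * Growth rates of almost additive sequences *)

Section almost_additive.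
Context (R : realType) (a : nat -> R) (B : R).
Context (aD : forall n k, `|a (n + k) - (a n + a k)| <= B).

Lemma almost_additiveM n k : `|a (k.+1 * n) - k.+1%:R * a n| <= k%:R * B.
Proof.
elim: k => [|k IHk]; first by rewrite mul1n !mul1r subrr normr0 mul0r.
rewrite mulSn; have := aD n (k.+1 * n); move: IHk; rewrite !ler_norml -!natr1.
by move=> /andP[? ?] /andP[? ?]; apply/andP; split; lra.
Qed.

(** Both [n a(k)] and [k a(n)] are close to [a(n k)]. *)
Lemma almost_additive_slope n k : (0 < n)%N -> (0 < k)%N ->
  n%:R * a k - k%:R * a n <= (n + k)%:R * B.
Proof.
case: n k => [//|n] [//|k] _ _.
have := almost_additiveM n.+1 k; have := almost_additiveM k.+1 n.
have B0 : 0 <= B by apply: le_trans (aD 0 0).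
rewrite mulnC !ler_norml => /andP[h1 h2] /andP[h3 h4].
rewrite natrD -!natr1 in h1 h2 h3 h4 *; lra.
Qed.

(** By [almost_additive_slope] the intervals of centre [a(n) / n] and radius [B
    / n] pairwise meet; hence they have a common point, the supremum of their
    left ends, and [a(n) / n] converges to it. *)
Lemma almost_additive_lim n :
  `|a n - n%:R * limn (fun k => k%:R^-1 * a k)| <= B.
Proof.
have B0 : 0 <= B by apply: le_trans (aD 0 0).
pose E := [set (a k - B) / k%:R | k in [set k | (0 < k)%N]].
have lb k : (0 < k)%N -> ubound E ((a k + B) / k%:R).
  move=> k0 _ [j /= j0 <-]; rewrite ler_pdivlMr ?ltr0n // mulrAC.
  rewrite ler_pdivrMr ?ltr0n //; have := almost_additive_slope k0 j0.
  by rewrite natrD; lra.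
have E0 : E !=set0 by exists ((a 1 - B) / 1%:R), 1%N.
have hE : has_sup E by split => //; exists ((a 1 + B) / 1%:R); exact: lb.
have close k : (0 < k)%N -> `|a k - k%:R * sup E| <= B.
  move=> k0; rewrite ler_norml.
  have : sup E <= (a k + B) / k%:R by apply: ge_sup => //; exact: lb.
  have : (a k - B) / k%:R <= sup E by apply: ub_le_sup; [case: hE|exists k].
  rewrite ler_pdivlMr ?ltr0n // ler_pdivrMr ?ltr0n // => h1 h2.
  by apply/andP; split; lra.
have lE : (fun k => k%:R^-1 * a k) @ \oo --> sup E.
  apply/cvgrPdist_le => e e0; near=> k.
  have k0 : (0 < k)%N by near: k; exact: nbhs_infty_gt.
  have -> : sup E - k%:R^-1 * a k = - (k%:R^-1 * (a k - k%:R * sup E)).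
    by rewrite mulrBr mulKf ?pnatr_eq0 -?lt0n // opprB.
  rewrite normrN normrM ger0_norm ?invr_ge0 // mulrC ler_pdivrMr ?ltr0n //.
  apply: le_trans (close k k0) _; rewrite -ler_pdivrMl //.
  near: k; exact: nbhs_infty_ger.
rewrite (cvg_lim _ lE) //.
case: n => [|n]; last exact: close.
by have := aD 0 0; rewrite addn0 mul0r subr0 opprD addrA subrr add0r normrN.
Unshelve. all: by end_near.
Qed.

End almost_additive.

Section pressure_bounds.
Context (R : realType) (T : finType) (w : seq T -> R) (r : nat) (c : R).
Context (wqm : quasi_multiplicative w r c).
Local Notation Z := (partition_sum w).
Local Notation D := (link_mass w r).

Definition growth_rate := limn (fun n => n%:R^-1 * ln (Z n)).

Lemma partition_sum_growth n :
  expR (n%:R * growth_rate) / (D / c) <= Z n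
    <= expR (n%:R * growth_rate) * (D / c).
Proof.
have c0 : 0 < c by case: wqm.
have D0 := link_mass_gt0 wqm; have Z0 := partition_sum_gt0 wqm.
have Dc0 : 0 < D / c by rewrite divr_gt0.
have h : `|ln (Z n) - n%:R * growth_rate| <= ln (D / c).
  apply: almost_additive_lim => k l; rewrite -lnM ?posrE // distrC ler_norml.
  (* the error is one-sided: it lies between [0] and [ln (D / c)] *)
  have le1 : ln (Z (k + l)) <= ln (Z k * Z l).
    by rewrite ler_ln ?posrE ?mulr_gt0 //; exact: partition_sumD wqm _ _.
  have le2 : ln (Z k * Z l) <= ln (D / c) + ln (Z (k + l)).
    have ZZ x y : 0 < Z x * Z y by rewrite mulr_gt0.
    have DZ : 0 < D / c * Z (k + l) by rewrite mulr_gt0.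
    rewrite -lnM ?posrE // ler_ln ?posrE // mulrAC ler_pdivlMr //.
    by rewrite mulrC; exact: partition_sum_super wqm _ _.
  by apply/andP; split; lra.
move: h; rewrite ler_norml => /andP[h1 h2].
rewrite -{1}[D / c]lnK ?posrE // -{2}[D / c]lnK ?posrE // -expRN -!expRD.
rewrite -{1 2}[Z n]lnK ?posrE // !ler_expR; apply/andP; split; lra.
Qed.

End pressure_bounds.

(** * Shift-invariant word frequencies *)

(** A cluster point exists by compactness; an ultrafilter that does not contain
    the preimage of a neighbourhood of it contains the complement, which is
    absurd. *)
Lemma ultra_bounded_cvg (R : realType) (X : Type) (U : set_system X)
    (UU : UltraFilter U) (u : X -> R) (a b : R) :
  (\forall n \near U, a <= u n <= b) -> cvg (u @ U).
Proof.
move=> uab.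
have Uab : (u @ U) `[a, b]%classic.
  by rewrite /=; apply: filterS uab => n; rewrite /= in_itv.
have [l [_ clul]] := @segment_compact R a b (u @ U) _ Uab.
apply/cvg_ex; exists l => V Vl.
have [//|UV] := in_ultra_setVsetC (u @^-1` V) UU.
by have [x [/= nVx Vx]] := clul (~` V) V UV Vl.
Qed.

Section invariant_weights.
Context (R : realType) (T : finType) (w : seq T -> R) (r : nat) (c : R).
Context (wqm : quasi_multiplicative w r c).
Local Notation Z := (partition_sum w).
Local Notation D := (link_mass w r).
Local Notation P := (growth_rate w).

(** Only the first half of the positions in words of length [2 N] is used, so
    that a fixed [s] eventually fits in at every one of them. *)
Definition word_frequency (N : nat) (s : seq T) : R :=
  N%:R^-1 * \sum_(0 <= i < N)
    (context_sum w i s (N.*2 - (i + size s)) / Z N.*2).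

Lemma word_frequency_rcons N s : (size s < N)%N ->
  word_frequency N s = \sum_(j : T) word_frequency N (rcons s j).
Proof.
move=> sN; rewrite /word_frequency -mulr_sumr exchange_big /=; congr (_ * _).
rewrite !big_nat; apply: eq_bigr => i /andP[_ iN]; rewrite -mulr_suml.
congr (_ / _).
have -> : (N.*2 - (i + size s) = (N.*2 - (i + (size s).+1)).+1)%N by lia.
rewrite context_sum_rcons; apply: eq_bigr => j _.
by rewrite size_rcons.
Qed.

Lemma word_frequency_bound N s i : (size s <= N)%N -> (i <= N)%N ->
  0 <= context_sum w i s (N.*2 - (i + size s)) / Z N.*2 <= 1.
Proof.
move=> sN iN; have Z0 := partition_sum_gt0 wqm.
rewrite divr_ge0 ?(ltW (Z0 _)) ?(context_sum_ge0 wqm) //=.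
rewrite ler_pdivrMr // mul1r; apply: le_trans (context_sum_le_partition wqm _ _ _) _.
rewrite subnKC //; lia.
Qed.


Lemma mean_bounds (g : nat -> R) (a b : R) N : (0 < N)%N ->
  (forall i, (i < N)%N -> a <= g i <= b) ->
  a <= N%:R^-1 * \sum_(0 <= i < N) g i <= b.
Proof.
move=> N0 gab; rewrite mulrC ler_pdivlMr ?ltr0n // ler_pdivrMr ?ltr0n //.
have cst x : x * N%:R = \sum_(0 <= i < N) x :> R.
  by rewrite big_const_nat iter_addr_0 subn0 mulr_natr.
by rewrite !cst; apply/andP; split; rewrite ler_sum_nat // => i /andP[_ /gab /andP[]].
Qed.

Lemma word_frequency_itv N s : (0 < N)%N -> (size s <= N)%N ->
  0 <= word_frequency N s <= 1.
Proof.
by move=> N0 sN; apply: mean_bounds => // i /ltnW iN; exact: word_frequency_bound.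
Qed.

Lemma word_frequency_nil N : (0 < N)%N -> word_frequency N [::] = 1.
Proof.
move=> N0; apply/le_anti; rewrite andbC; apply: mean_bounds => // i iN.
rewrite /context_sum addn0 /=.
rewrite -(big_tuple_cat i (N.*2 - i) w) subnKC; last by lia.
by rewrite divff ?lexx // gt_eqF // (partition_sum_gt0 wqm).
Qed.

(** Prepending a letter shifts the positions by one, so that only the two
    extreme positions contribute to the difference. *)
Lemma word_frequency_cons N s : (size s < N)%N ->
  `|\sum_(j : T) word_frequency N (j :: s) - word_frequency N s| <= N%:R^-1.
Proof.
move=> sN; have N0 : (0 < N)%N by lia.
pose g i := context_sum w i s (N.*2 - (i + size s)) / Z N.*2.
have -> : \sum_(j : T) word_frequency N (j :: s) =
    N%:R^-1 * \sum_(0 <= i < N) g i.+1.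
  rewrite /word_frequency -mulr_sumr exchange_big /=; congr (_ * _).
  rewrite !big_nat; apply: eq_bigr => i /andP[_ iN]; rewrite -mulr_suml.
  by rewrite /g context_sum_cons addSn addnS.
rewrite -mulrBr -sumrB telescope_sumr // normrM ger0_norm ?invr_ge0 //.
rewrite ler_piMr ?invr_ge0 //.
have /andP[gN0 gN1] := @word_frequency_bound N s N (ltnW sN) (leqnn _).
have /andP[g00 g01] := @word_frequency_bound N s 0 (ltnW sN) (leq0n _).
by rewrite ler_norml /g; apply/andP; split; lra.
Qed.

(** The constants collect two factors [c / D] of [context_sum_ge], used only in
    the lower bound, and the three comparisons of [Z i], [Z k] and [Z (2 N)]
    with exponentials, each of which costs [D / c]. *)
Lemma word_frequency_gibbs N s : (size s < N)%N ->
  (D / c) ^- 5 * (expR (- ((size s)%:R * P)) * w s) <= word_frequency N s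
    <= (D / c) ^+ 3 * (expR (- ((size s)%:R * P)) * w s).
Proof.
move=> sN; have [w_ge0 _ _ c0 _] := wqm.
have D0 := link_mass_gt0 wqm; have Z0 := partition_sum_gt0 wqm.
have B0 : 0 < D / c by rewrite divr_gt0.
apply: mean_bounds => [|i iN]; first by lia.
set k := (N.*2 - _)%N; have e2N : (N.*2 = i + size s + k)%N by rewrite /k; lia.
have /andP[li ui] := partition_sum_growth wqm i.
have /andP[lk uk] := partition_sum_growth wqm k.
have /andP[lN uN] := partition_sum_growth wqm N.*2.
have eN : expR (N.*2%:R * P) =
    expR (i%:R * P) * (expR (- ((size s)%:R * P)))^-1 * expR (k%:R * P).
  by rewrite -expRN opprK -!expRD e2N !natrD !mulrDl.
move: B0 li ui lk uk lN uN; rewrite {}eN.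
have -> : (D / c) ^- 5 = (c / D) ^+ 2 * (D / c) ^- 3.
  by rewrite -[c / D]invf_div exprVn -invfM -exprD.
set B := D / c; move: (expR_gt0 (i%:R * P)) (expR_gt0 (- ((size s)%:R * P))).
move: (expR_gt0 (k%:R * P)) (Z0 i) (Z0 k) (Z0 N.*2) (w_ge0 s).
move: (context_sum_le wqm i s k) (context_sum_ge wqm i s k).
set x := expR (i%:R * P); set y := expR (k%:R * P).
set z := expR (- ((size s)%:R * P)).
set Zi := Z i; set Zk := Z k; set ZN := Z N.*2.
set C := (c / D) ^+ 2 => hu hl y0 Zi0 Zk0 ZN0 ws x0 z0 B0 li ui lk uk lN uN.
have C0 : 0 < C by rewrite exprn_gt0 // divr_gt0.
apply/andP; split.
  rewrite ler_pdivlMr //; apply: le_trans hl.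
  have -> : C * B ^- 3 * (z * w s) * ZN = C * ((B ^- 3 * z * ZN) * w s) by ring.
  rewrite ler_pM2l //.
  rewrite [leRHS]mulrAC ler_wpM2r //.
  apply: le_trans (_ : (x / B) * (y / B) <= _); last first.
    by apply: ler_pM => //; rewrite divr_ge0 // ltW.
  apply: le_trans (_ : B ^- 3 * z * (x / z * y * B) <= _).
    by rewrite ler_pM2l // mulr_gt0 // invr_gt0 exprn_gt0.
  rewrite le_eqVlt; apply/orP; left; apply/eqP; field.
  by rewrite !gt_eqF.
rewrite ler_pdivrMr //; apply: le_trans hu _.
have -> : B ^+ 3 * (z * w s) * ZN = (B ^+ 3 * z * ZN) * w s by ring.
rewrite [leLHS]mulrAC ler_wpM2r //.
apply: le_trans (_ : (x * B) * (y * B) <= _).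
  by apply: ler_pM => //; exact: ltW.
apply: le_trans (_ : B ^+ 3 * z * (x / z * y / B) <= _); last first.
  by rewrite ler_pM2l // mulr_gt0 // exprn_gt0.
rewrite le_eqVlt; apply/orP; left; apply/eqP; field.
by rewrite !gt_eqF.
Qed.

Definition gibbs_weights (f : seq T -> R) : Prop :=
  exists C1 C2 : R, [/\ 0 < C1, 0 < C2 & forall s,
    C1 * (expR (- ((size s)%:R * P)) * w s) <= f s
      <= C2 * (expR (- ((size s)%:R * P)) * w s)].

(** An ultrafilter gives the limits for all words at once, without extracting
    subsequences; limits along it are additive, and it contains every set of
    large integers. *)
Lemma invariant_gibbs_weights : exists f : seq T -> R,
  [/\ f [::] = 1, forall s, f s = \sum_(j : T) f (rcons s j),
    forall s, f s = \sum_(j : T) f (j :: s) & gibbs_weights f].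
Proof.
have [w_ge0 _ _ c0 _] := wqm; have D0 := link_mass_gt0 wqm.
have [U [UU Uoo]] := ultraFilterLemma (eventually_filter : ProperFilter \oo).
pose f s : R := lim (word_frequency ^~ s @ U).
have near_gt n : \forall N \near U, (n < N)%N by apply: Uoo; exact: nbhs_infty_gt.
have fE s : word_frequency ^~ s @ U --> f s.
  apply: (@ultra_bounded_cvg _ _ _ _ _ 0 1).
  apply: filterS (near_gt (size s)) => N sN.
  by apply: word_frequency_itv; lia.
have sum_cvg (h : T -> seq T) :
    (fun N => \sum_(j : T) word_frequency N (h j)) @ U --> \sum_(j : T) f (h j).
  elim: (index_enum T) => [|j l IHl].
    by rewrite big_nil; under eq_cvg do rewrite big_nil; exact: cvg_cst.
  rewrite big_cons; under eq_cvg do rewrite big_cons.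
  exact: (cvgD (fE _) IHl).
exists f; split.
- apply: cvg_lim => //; apply: cvg_near_cst.
  by apply: filterS (near_gt 0) => N N0; rewrite word_frequency_nil.
- move=> s; apply: cvg_lim => //; apply: cvg_trans (sum_cvg (rcons s)).
  apply: near_eq_cvg.
  by apply: filterS (near_gt (size s)) => N sN; rewrite -word_frequency_rcons.
- move=> s; apply/eqP; rewrite eq_sym -subr_eq0; apply/eqP.
  pose g N := \sum_(j : T) word_frequency N (j :: s) - word_frequency N s.
  have g1 : g @ U --> \sum_(j : T) f (j :: s) - f s.
    exact: cvgB (sum_cvg _) (fE s).
  rewrite -(cvg_lim _ g1) //; apply: cvg_lim => //.
  apply: (@cvg_trans _ (g @ \oo)); first exact: cvg_app.
  apply/cvgr0Pnorm_le => e e0; near=> N.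
  apply: le_trans (word_frequency_cons _) _; first by near: N; exact: nbhs_infty_gt.
  rewrite -[e]invrK lef_pV2 ?posrE ?invr_gt0 //; last first.
    by rewrite ltr0n; near: N; exact: nbhs_infty_gt.
  near: N; exact: nbhs_infty_ger.
- exists ((D / c) ^- 5), ((D / c) ^+ 3); split.
  + by rewrite invr_gt0 exprn_gt0 // divr_gt0.
  + by rewrite exprn_gt0 // divr_gt0.
  move=> s; apply/andP; split.
    apply: limr_ge; first by apply/cvg_ex; exists (f s); exact: fE.
    by apply: filterS (near_gt (size s)) => N /word_frequency_gibbs /andP[].
  apply: limr_le; first by apply/cvg_ex; exists (f s); exact: fE.
  by apply: filterS (near_gt (size s)) => N /word_frequency_gibbs /andP[].
Unshelve. all: by end_near.
Qed.

End invariant_weights.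

(** * Cylinders generate the Borel sets *)

Section cylinder_sets.
Context (R : realType) (m : nat) (A : 'M[nat]_m) (A0 : SigmaA A !=set0).
Local Notation S := (sft R A0).
Local Notation X := (borel_sft R A0).
Implicit Types (s t : seq 'I_m) (x y : S).

Local Notation shift := (@sft_shift R m A A0).

Definition prefix_of x n : seq 'I_m := mkseq (sft_seq x) n.

(** Cylinders indexed by plain sequences, which unlike tuples may be
    concatenated and cut without casts. *)
Definition word_cylinder s : set S := [set x | prefix_of x (size s) = s].
Local Notation cyl := word_cylinder.

Lemma size_prefix_of x n : size (prefix_of x n) = n.
Proof. exact: size_mkseq. Qed.

Lemma prefix_ofS x n : prefix_of x n.+1 = sft_seq x 0 :: prefix_of (sft_shift x) n.
Proof.
rewrite /prefix_of /mkseq /=; congr (_ :: _).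
by rewrite -[1%N]addn0 iotaDl -map_comp; exact: eq_map.
Qed.

Lemma prefix_ofD x n k :
  prefix_of x (n + k) = prefix_of x n ++ prefix_of (iter n shift x) k.
Proof.
elim: n x => [//|n IHn] x; rewrite addSn !prefix_ofS IHn cat_cons.
by rewrite -iterSr.
Qed.

Lemma cylinderE n (J : n.-tuple 'I_m) : cylinder J = cyl J :> set S.
Proof.
apply/seteqP; split => x /=; rewrite /cylinder /word_cylinder /= size_tuple => xJ.
  apply: (@eq_from_nth _ (sft_seq x 0)); rewrite ?size_prefix_of ?size_tuple //.
  move=> i iN; rewrite nth_mkseq // -[i]/(val (Ordinal iN)) xJ.
  exact: tnth_nth.
by move=> i; rewrite (tnth_nth (sft_seq x 0)) -xJ nth_mkseq.
Qed.

Lemma word_cylinder_nil : cyl [::] = setT.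
Proof. by apply/seteqP. Qed.

Lemma word_cylinder_prefix x n : cyl (prefix_of x n) x.
Proof. by rewrite /word_cylinder /= size_prefix_of. Qed.

Lemma word_cylinder_cat s t : cyl (s ++ t) =
  cyl s `&` iter (size s) shift @^-1` cyl t.
Proof.
apply/seteqP; split => x; rewrite /word_cylinder /= size_cat prefix_ofD.
  by move=> /eqP; rewrite eqseq_cat ?size_prefix_of // => /andP[/eqP ? /eqP ?].
by move=> [-> ->].
Qed.

Lemma word_cylinder_sorted s : cyl s !=set0 -> sorted (allowed A) s.
Proof.
move=> [x]; rewrite /word_cylinder /= => <-.
move: (size s) => {s} [//|n]; apply/(sortedP (sft_seq x 0)) => i.
rewrite size_prefix_of => iN; rewrite !nth_mkseq //; last exact: ltnW.
by have := svalP x; rewrite inE; exact.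
Qed.

Lemma word_cylinder_disj s t : size s = size t -> s != t -> cyl s `&` cyl t = set0.
Proof.
move=> st /eqP ne; rewrite -subset0 => x [/= xs xt]; apply: ne.
by rewrite -xs st xt.
Qed.

Lemma word_cylinder_rcons s :
  cyl s = \big[setU/set0]_(j : 'I_m) cyl (rcons s j).
Proof.
rewrite -bigcup_seq; apply/seteqP; split => [x xs|x [j _]]; last first.
  by rewrite -cats1 word_cylinder_cat => -[].
exists (sft_seq (iter (size s) shift x) 0); first exact: mem_index_enum.
by rewrite -cats1 word_cylinder_cat.
Qed.

Context (m_ge2 : (1 < m)%N).

Lemma open_word_cylinder s : open (cyl s).
Proof.
rewrite openE => x /= xs; apply/nbhs_ballP; exists (m%:R ^- (size s)) => /=.
  by rewrite invr_gt0 exprn_gt0 // ltr0n; case: (sft_seq x 0) => /= k; case: (m).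
move=> y; rewrite ballEmdist /= /word_cylinder /= -[in RHS]xs /mdist /= /sft_dist.
case: shift_distP => [xy _|n xyn xyk m1 lt].
  by rewrite /prefix_of xy.
apply: (@eq_from_nth _ (sft_seq x 0)); rewrite ?size_prefix_of // => i iN.
rewrite !nth_mkseq //; apply/esym/xyk; apply: leq_trans iN _.
move: lt; rewrite ltf_pV2 ?posrE ?exprn_gt0 ?ltr0n ?(ltnW m1) //.
by rewrite ltr_eXn2l ?ltr1n // ltnS.
Qed.

(** Every ball contains the cylinder of a long enough prefix of its centre; as
    there are countably many words, the open sets are countable unions of
    cylinders. *)
Lemma open_bigcup_cylinder (U : set S) : open U ->
  U = \bigcup_(s in [set s | cyl s `<=` U]) cyl s.
Proof.
move=> oU; apply/seteqP; split => [x Ux|x [s /= sU /sU //]].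
have /nbhs_ballP[e /= e0 eU] : nbhs x U by exact: open_nbhs_nbhs.
have [n ne] : exists n, m%:R ^- n.+1 < e.
  have : (fun n => (m%:R^-1 : R) ^+ n) @ \oo --> 0.
    apply: cvg_expr; rewrite ger0_norm ?invr_ge0 // invf_lt1 ?ltr1n //.
    by rewrite ltr0n ltnW.
  move=> /cvgr0Pnorm_lt /(_ _ e0) [n _ /(_ n.+1 (leqnSn n))] /=.
  by rewrite exprVn ger0_norm ?invr_ge0 ?exprn_ge0 // => ?; exists n.
exists (prefix_of x n); last exact: word_cylinder_prefix.
move=> y; rewrite /word_cylinder /= size_prefix_of => yx; apply: eU.
rewrite ballEmdist /= /mdist /= /sft_dist; case: shift_distP => [//|k xyk _ _].
apply: le_lt_trans ne; rewrite lef_pV2 ?posrE ?exprn_gt0 ?ltr0n ?(ltnW m_ge2) //.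
rewrite ler_eXn2l ?ltr1n // ltnS leqNgt; apply/negP => kn; move/eqP: xyk; apply.
have := congr1 (fun s => nth (sft_seq x 0) s k) yx.
by rewrite !nth_mkseq.
Qed.

(** The empty set is added because disjoint cylinders must meet in a member of
    the class, while there may be no word with an empty cylinder. *)
Definition cylinder_class : set (set X) :=
  [set B | B = set0 \/ exists s, B = cyl s].

Lemma measurable_cylinder_class : @measurable _ X = <<s cylinder_class >>.
Proof.
apply/seteqP; split.
  apply: smallest_sub; first exact: smallest_sigma_algebra.
  move=> U oU; rewrite (open_bigcup_cylinder oU) bigcup_mkcond.
  apply: (@countable_bigcupT_measurable _ (g_sigma_algebraType cylinder_class)).
    exact: countableP.
  move=> s; case: ifPn => _; last exact: measurable0.
  by apply: sub_sigma_algebra; right; exists s.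
apply: smallest_sub; first exact: sigma_algebra_measurable.
move=> B [->|[s ->]]; first exact: measurable0.
by apply: sub_sigma_algebra; exact: open_word_cylinder.
Qed.

Lemma measurable_word_cylinder s : measurable (cyl s : set X).
Proof. by apply: sub_sigma_algebra; exact: open_word_cylinder. Qed.

(** Two cylinders are nested or disjoint, according to whether one word is a
    prefix of the other. *)
Lemma cylinder_class_setI : setI_closed cylinder_class.
Proof.
move=> B C [-> _|[s ->] [->|[t ->]]].
- by left; rewrite set0I.
- by left; rewrite setI0.
wlog st : s t / (size s <= size t)%N.
  move=> h; case/orP: (leq_total (size s) (size t)) => st; first exact: h.
  by rewrite setIC; exact: h.
have [e|ne] := eqVneq s (take (size s) t).
  right; exists t; rewrite setIidr // -[t](cat_take_drop (size s)) -e.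
  by rewrite word_cylinder_cat; exact: subIsetl.
left; rewrite -[t](cat_take_drop (size s)) word_cylinder_cat setIA.
by rewrite word_cylinder_disj ?set0I // size_takel.
Qed.

Lemma measurable_to_sft d (Y : measurableType d) (g : Y -> X) :
  (forall s, measurable (g @^-1` cyl s)) -> measurable_fun setT g.
Proof.
move=> gm.
apply: (@measurability _ _ Y X setT g cylinder_class measurable_cylinder_class).
move=> _ [_ [->|[s ->]] <-]; first by rewrite preimage_set0 setI0; exact: measurable0.
by rewrite setTI.
Qed.

Lemma word_cylinder_shift s :
  shift @^-1` cyl s = \big[setU/set0]_(j : 'I_m) cyl (j :: s).
Proof.
rewrite -bigcup_seq; apply/seteqP; split => [x xs|x [j _]]; last first.
  by rewrite -cat1s word_cylinder_cat => -[].
exists (sft_seq x 0); first exact: mem_index_enum.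
by rewrite -cat1s word_cylinder_cat.
Qed.

Lemma measurable_shift : measurable_fun setT (shift : X -> X).
Proof.
apply: measurable_to_sft => s; rewrite word_cylinder_shift.
apply: bigsetU_measurable => j _; exact: measurable_word_cylinder.
Qed.

End cylinder_sets.

(** * Operations on measures *)

(** These operations are stated as existence results so that a measure
    structure is at hand without naming the proofs on which it depends. *)
Section measure_transport.
Context d d' (T : measurableType d) (T' : measurableType d') (R : realType).

Lemma push_measure_exists (mu : {measure set T -> \bar R}) (g : T -> T') :
  measurable_fun setT g -> exists nu : {measure set T' -> \bar R},
    forall B, nu B = mu (g @^-1` B).
Proof.
move=> mg; unshelve eexists (pushforward mu g : {measure set T' -> \bar R}) => //.
Qed.

Lemma restr_measure_exists (mu : {measure set T -> \bar R}) (D : set T) :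
  measurable D -> exists nu : {measure set T -> \bar R},
    forall B, nu B = mu (B `&` D).
Proof. by move=> mD; exists (mrestr mu mD). Qed.

End measure_transport.

Section measure_operations.
Context d (T : measurableType d) (R : realType).

Lemma scale_measure_exists (mu : {measure set T -> \bar R}) (a : R) :
  0 <= a -> exists nu : {measure set T -> \bar R},
    forall B, nu B = (a%:E * mu B)%E.
Proof. by move=> a0; exists (mscale (NngNum a0) mu). Qed.

Lemma sum_measure_exists (mu : nat -> {measure set T -> \bar R}) n :
  exists nu : {measure set T -> \bar R},
    forall B, nu B = (\sum_(1 <= k < n.+1) mu k B)%E.
Proof.
exists (msum (fun k => mu k.+1) n) => B.
by rewrite /msum /= big_add1 big_mkord.
Qed.

Lemma add_measure_exists (mu nu : {measure set T -> \bar R}) :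
  exists rho : {measure set T -> \bar R}, forall B, rho B = (mu B + nu B)%E.
Proof. by exists (measure_add mu nu) => B; exact: measure_addE. Qed.

Lemma probability_measure_exists (mu : {measure set T -> \bar R}) :
  mu setT = 1%E -> exists nu : probability T R, forall B, nu B = mu B.
Proof.
move=> mu1; exists (mnormalize mu point) => B.
by rewrite /= /mnormalize mu1 onee_eq0 /= invr1 mule1.
Qed.

End measure_operations.

(** * Measures with prescribed cylinder masses *)

Section coding.
Context (R : realType) (m : nat) (f : seq 'I_m -> R).
Context (f_ge0 : forall s, 0 <= f s).
Context (f_rcons : forall s, f s = \sum_(j : 'I_m) f (rcons s j)).

(** The interval of a word [p] is cut into consecutive intervals of lengths
    [f (rcons p i)]; this is the offset of the interval of [p ++ s] inside that
    of [p]. *)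
Fixpoint left_end_from (p s : seq 'I_m) : R :=
  if s is j :: s' then
    \sum_(i : 'I_m | (i < j)%N) f (rcons p i) + left_end_from (rcons p j) s'
  else 0.

Lemma left_end_from_rcons p s j : left_end_from p (rcons s j) =
  left_end_from p s + \sum_(i : 'I_m | (i < j)%N) f (rcons (p ++ s) i).
Proof.
elim: s p => [|i s IHs] p /=; first by rewrite cats0 addr0 add0r.
by rewrite IHs cat_rcons addrA.
Qed.

Definition left_end := left_end_from [::].

(** Half-open on the right, so that the intervals of the one-letter extensions
    of a word partition its interval exactly. *)
Definition code_interval s : set R := `[left_end s, left_end s + f s[%classic.
Local Notation I := code_interval.

Let part s k := \sum_(i : 'I_m | (i < k)%N) f (rcons s i).

Let partS s (j : 'I_m) : part s j.+1 = part s j + f (rcons s j).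
Proof.
rewrite /part (bigD1 j) //= addrC; congr (_ + _); apply: eq_bigl => i.
by rewrite ltnS andbC [RHS]ltn_neqAle.
Qed.

Let part_le s k l : (k <= l)%N -> part s k <= part s l.
Proof.
move=> kl; rewrite /part [leLHS]big_mkcond [leRHS]big_mkcond /=.
apply: ler_sum => i _; case: ifPn => [ik|_]; last by case: ifP.
by rewrite (leq_trans ik kl).
Qed.

Let code_intervalP s (j : 'I_m) x :
  I (rcons s j) x <-> left_end s + part s j <= x < left_end s + part s j.+1.
Proof.
by rewrite /I /= in_itv /= {1 2}/left_end left_end_from_rcons cat0s partS addrA.
Qed.

Lemma code_interval_rcons s j : I (rcons s j) `<=` I s.
Proof.
move=> x /code_intervalP /andP[lx xu]; rewrite /I /= in_itv /=; apply/andP; split.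
  by apply: le_trans lx; rewrite lerDl sumr_ge0.
apply: lt_le_trans xu _; rewrite lerD2l f_rcons.
have -> : \sum_(i < m) f (rcons s i) = part s m.
  by apply: eq_bigl => i; rewrite ltn_ord.
exact: part_le.
Qed.

(** The letter is found as the last one whose preceding letters have total
    length at most the offset of [x]. *)
Lemma code_interval_split s x : I s x -> exists j, I (rcons s j) x.
Proof.
rewrite /I /= in_itv /= => /andP[lx xu].
have ex : exists k, (k <= m)%N && (x < left_end s + part s k).
  exists m; rewrite leqnn (lt_le_trans xu) // lerD2l f_rcons.
  by rewrite le_eqVlt; apply/orP; left; apply/eqP/eq_bigl => i; rewrite ltn_ord.
case: (ex_minnP ex) => -[|k] /andP[km xk] kmin.
  by move: xk; rewrite /part big_pred0 // addr0 ltNge lx.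
exists (Ordinal km); apply/code_intervalP => /=; rewrite xk andbT leNgt.
by apply/negP => xk'; have := kmin k; rewrite (ltnW km) xk' ltnn => /(_ isT).
Qed.

Lemma code_interval_uniq s i j x : I (rcons s i) x -> I (rcons s j) x -> i = j.
Proof.
move=> /code_intervalP/andP[li ui] /code_intervalP/andP[lj uj].
have no k l : (k < l)%N -> left_end s + part s l <= x ->
    x < left_end s + part s k.+1 -> False.
  move=> kl lx; rewrite ltNge; move/negP; apply; apply: le_trans lx.
  by rewrite lerD2l part_le.
apply: ord_inj; case: (ltngtP i j) => // lt; exfalso.
  exact: no lt lj ui.
exact: no lt li uj.
Qed.

Context (j0 : 'I_m).

(** The default letter [j0] is only used for points outside the interval of the
    empty word. *)
Definition code_step x s : seq 'I_m :=
  rcons s (odflt j0 [pick j | `[< I (rcons s j) x >]]).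
Definition code_prefix x n := iter n (code_step x) [::].
Definition code x n : 'I_m :=
  odflt j0 [pick j | `[< I (rcons (code_prefix x n) j) x >]].

Lemma code_prefixE x n : code_prefix x n = mkseq (code x) n.
Proof.
elim: n => [//|n IHn]; rewrite /code_prefix iterS -/(code_prefix x n).
by rewrite mkseqS -IHn.
Qed.

Lemma code_prefix_in x n : I [::] x -> I (code_prefix x n) x.
Proof.
move=> x0; elim: n => [//|n /code_interval_split [j xj]].
rewrite /code_prefix iterS /code_step -/(code_prefix x n).
by case: pickP => [i /asboolP //|/(_ j) /asboolPn].
Qed.

Lemma code_intervalE x s : I [::] x -> I s x <-> mkseq (code x) (size s) = s.
Proof.
move=> x0; split=> [|<-]; last by rewrite -code_prefixE; exact: code_prefix_in.
elim/last_ind: s => [//|s j IHs] xs; have e := IHs (code_interval_rcons xs).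
rewrite size_rcons mkseqS e; congr rcons; apply: (code_interval_uniq _ xs (s := s)).
by have := @code_prefix_in x (size s).+1 x0; rewrite code_prefixE mkseqS e.
Qed.

Lemma code_mass_gt0 x n : I [::] x -> 0 < f (mkseq (code x) n).
Proof.
move=> /(@code_prefix_in x n); rewrite code_prefixE /I /= in_itv /=.
by move=> /andP[lx] /(le_lt_trans lx); rewrite ltrDl.
Qed.

Lemma code_interval_sub s : I s `<=` I [::].
Proof.
by elim/last_ind: s => [//|s j IHs] x /code_interval_rcons; exact: IHs.
Qed.

End coding.

Section extension.
Context (R : realType) (m : nat) (A : 'M[nat]_m) (A0 : SigmaA A !=set0).
Context (m_ge2 : (1 < m)%N).
Local Notation X := (borel_sft R A0).
Local Notation cyl := (@word_cylinder R m A A0).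

(** Lebesgue measure of the interval of [s] is [f s], and the points of that
    interval are those whose code starts with [s]. The code of a point is
    admissible because the intervals of inadmissible words are empty; the
    points outside the interval of the empty word are sent to an arbitrary
    sequence, whose mass is discarded by restricting Lebesgue measure. *)
Theorem cylinder_extension (f : seq 'I_m -> R) :
  (forall s, 0 <= f s) -> (forall s, f s = \sum_(j : 'I_m) f (rcons s j)) ->
  (forall s, ~~ sorted (allowed A) s -> f s = 0) ->
  exists mu : {measure set X -> \bar R}, forall s, mu (cyl s) = (f s)%:E.
Proof.
move=> f_ge0 f_rcons f_adm.
pose I := code_interval f; pose p : sft R A0 := point.
pose z x := code f (sft_seq p 0) x.
have zA x : I [::] x -> z x \in SigmaA A.
  move=> x0; rewrite inE => k.
  have := code_mass_gt0 f_rcons (sft_seq p 0) k.+2 x0.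
  rewrite lt_neqAle eq_sym => /andP[f0 _].
  have /sortedP : sorted (allowed A) (mkseq (z x) k.+2).
    by apply: contraNT f0 => /f_adm/eqP.
  by move=> /(_ (z x 0) k); rewrite size_mkseq !nth_mkseq //; exact.
pose g x : X := if pselect (I [::] x) is left x0 then SigSub (zA x x0) else p.
have gcyl s : g @^-1` cyl s = I s `|` (~` I [::] `&` [set _ | cyl s p]).
  apply/seteqP; split => x; rewrite /= /g; case: pselect => x0.
  - by move=> xs; left; apply/(code_intervalE f_ge0 f_rcons (sft_seq p 0)).
  - by right.
  - by case=> [/(code_intervalE f_ge0 f_rcons (sft_seq p 0))|[]]//; exact.
  - by case=> [/(code_interval_sub f_ge0 f_rcons)|[]].
have mI s : measurable (I s) by exact: measurable_itv.
have mg : measurable_fun setT g.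
  apply: measurable_to_sft => // s; rewrite gcyl; apply: measurableU => //.
  apply: measurableI; first exact: measurableC.
  have [ps|ps] := pselect (cyl s p).
    by rewrite (_ : [set _ | _] = setT) //; apply/seteqP; split.
  by rewrite (_ : [set _ | _] = set0) //; apply/seteqP; split.
have [rho rhoE] := restr_measure_exists (@lebesgue_measure R) (mI [::]).
have [mu muE] := push_measure_exists rho mg.
exists mu => s; rewrite muE rhoE gcyl setIUl setIAC setICl set0I setU0.
rewrite setIidl; last exact: code_interval_sub.
apply: etrans (lebesgue_measure_itv `[left_end f s, left_end f s + f s[) _.
rewrite /= lte_fin ltrDl.
have := f_ge0 s; rewrite le_eqVlt => /orP[/eqP <-|->]; first by rewrite ltxx.
by rewrite -EFinB addrAC subrr add0r.
Qed.

End extension.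

(** * Invariant probabilities with trivial subinvariant sets *)

Section invariant_uniqueness.
Context d (T : measurableType d) (R : realType) (shift : T -> T).
Context (mshift : measurable_fun setT shift).

Definition invariant_measure (mu : set T -> \bar R) :=
  forall B, measurable B -> mu (shift @^-1` B) = mu B.

(** For an invariant probability this is ergodicity: a set contained in its
    preimage differs from it by a null set. It is the form in which the orbit
    set [C] of [invariant_probability_unique] is met. *)
Definition subinvariant_trivial (mu : set T -> \bar R) :=
  forall C, measurable C -> C `<=` shift @^-1` C -> mu C = 0%E \/ mu C = 1%E.

Let mpre B : measurable B -> measurable (shift @^-1` B).
Proof. by move=> mB; rewrite -[X in measurable X]setTI; exact: mshift. Qed.

Lemma measurable_iter_preimage n B : measurable B ->
  measurable (iter n shift @^-1` B).
Proof.
elim: n B => [//|n IHn] B mB.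
by rewrite (_ : _ @^-1` B = iter n shift @^-1` (shift @^-1` B)); [exact/IHn/mpre|].
Qed.

Lemma invariant_iter mu n B : invariant_measure mu -> measurable B ->
  mu (iter n shift @^-1` B) = mu B.
Proof.
move=> inv; elim: n B => [//|n IHn] B mB.
rewrite (_ : _ @^-1` B = iter n shift @^-1` (shift @^-1` B)); last by [].
by rewrite IHn ?inv //; exact: mpre.
Qed.

Lemma hahn_probability (mu nu : probability T R) : exists2 P, measurable P &
  (forall B, measurable B -> B `<=` P -> (mu B <= nu B)%E) /\
  (forall B, measurable B -> B `<=` ~` P -> (nu B <= mu B)%E).
Proof.
pose k := cadd (charge_of_finite_measure nu)
  (cscale (-1) (charge_of_finite_measure mu)).
have [P [N [[mP posP] [mN negN] PNT PN0]]] := Hahn_decomposition k.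
have kE B : k B = (nu B - mu B)%E.
  by rewrite /k /cadd /=; rewrite /cscale EFinN mulN1e.
exists P => //; split => B mB BP.
  have : (0 <= k B)%E := posP _ mB BP.
  by rewrite kE sube_ge0 // fin_num_measure.
have : (k B <= 0)%E.
  by apply: negN => // x /BP nPx; have : setT x by []; rewrite -PNT => -[].
by rewrite kE sube_le0.
Qed.

(** Writing [a = nu - mu] and [P] for a positive set of [a], invariance shows
    that [a] vanishes on the parts of [P] and of its preimage that are not
    common to both, so that [P] may be replaced by its preimage in [a (B /\
    P)]. Hence the set of points of [P] that have left [P] at time [n] is
    [a]-null for each [n], and [a] is concentrated on [C] inside [P]. If [C] is
    null for [mu], it is null for [nu] and [a <= 0] everywhere; if its
    complement is null, [a >= 0]. *)
Theorem invariant_probability_unique (mu nu : probability T R) :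
  invariant_measure mu -> invariant_measure nu -> subinvariant_trivial mu ->
  (forall B, measurable B -> mu B = 0%E -> nu B = 0%E) ->
  forall B, measurable B -> nu B = mu B.
Proof.
move=> imu inu tmu nu_mu.
have [P mP [posP negP]] := hahn_probability mu nu.
pose a B := fine (nu B) - fine (mu B).
have fmu B : measurable B -> mu B \is a fin_num.
  by move=> ?; exact: fin_num_measure.
have fnu B : measurable B -> nu B \is a fin_num.
  by move=> ?; exact: fin_num_measure.
have a_eq B : measurable B -> a B = 0 -> nu B = mu B.
  move=> mB /eqP; rewrite subr_eq0 => /eqP e.
  by rewrite -(fineK (fnu _ mB)) -(fineK (fmu _ mB)) e.
have a_split B C : measurable B -> measurable C -> a B = a (B `&` C) + a (B `\` C).
  move=> mB mC; have mI : measurable (B `&` C) by exact: measurableI.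
  have mD : measurable (B `\` C) by exact: measurableD.
  rewrite /a (measureDI nu mB mC) (measureDI mu mB mC).
  by rewrite !fineD ?fmu ?fnu //; lra.
have a_inv B : measurable B -> a (shift @^-1` B) = a B.
  by move=> mB; rewrite /a imu ?inu.
have a_ge0 B : measurable B -> B `<=` P -> 0 <= a B.
  by move=> mB BP; rewrite subr_ge0 fine_le ?fmu ?fnu ?posP.
have a_le0 B : measurable B -> B `<=` ~` P -> a B <= 0.
  by move=> mB BP; rewrite subr_le0 fine_le ?fmu ?fnu ?negP.
have aT : a setT = 0 by rewrite /a !probability_setT subrr.
(* a charge of constant sign that vanishes on [C] vanishes on its subsets *)
have a_sub0 B C : measurable B -> measurable C -> C `<=` P -> a C = 0 ->
    a (B `&` C) = 0.
  move=> mB mC CP aC; have := a_split C B mC mB; rewrite aC setIC.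
  have : 0 <= a (B `&` C) by apply: a_ge0; [exact: measurableI|move=> x [_ /CP]].
  have : 0 <= a (C `\` B) by apply: a_ge0; [exact: measurableD|move=> x [/CP]].
  lra.
have a_sub0' B C : measurable B -> measurable C -> C `<=` ~` P -> a C = 0 ->
    a (B `&` C) = 0.
  move=> mB mC CP aC; have := a_split C B mC mB; rewrite aC setIC.
  have : a (B `&` C) <= 0 by apply: a_le0; [exact: measurableI|move=> x [_ /CP]].
  have : a (C `\` B) <= 0 by apply: a_le0; [exact: measurableD|move=> x [/CP]].
  lra.
have mP1 : measurable (shift @^-1` P) by exact: mpre.
have mD1 : measurable (P `\` shift @^-1` P) by exact: measurableD.
have mD2 : measurable (shift @^-1` P `\` P) by exact: measurableD.
have [aD1 aD2] : a (P `\` shift @^-1` P) = 0 /\ a (shift @^-1` P `\` P) = 0.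
  have := a_split P _ mP mP1; have := a_split _ P mP1 mP.
  rewrite a_inv // [_ `&` P]setIC => e1 e2.
  have : 0 <= a (P `\` shift @^-1` P) by apply: a_ge0 => // x [].
  have : a (shift @^-1` P `\` P) <= 0 by apply: a_le0 => // x [].
  by move=> ? ?; split; lra.
have swap B : measurable B -> a (B `&` P) = a (B `&` shift @^-1` P).
  move=> mB.
  rewrite (a_split (B `&` P) (shift @^-1` P)) //; last exact: measurableI.
  rewrite (a_split (B `&` shift @^-1` P) P) //; last exact: measurableI.
  rewrite -!setIDA (a_sub0 B _ mB mD1) //.
  rewrite (a_sub0' B _ mB mD2) //.
  by rewrite setIAC.
pose W n := P `&` iter n shift @^-1` (~` P).
have mW n : measurable (W n).
  by apply: measurableI => //; apply: measurable_iter_preimage; exact: measurableC.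
have aW n : a (W n) = 0.
  elim: n => [|n IHn]; first by rewrite /W setICr /a !measure0 subrr.
  rewrite /W setIC swap; last first.
    by apply: measurable_iter_preimage; exact: measurableC.
  rewrite -IHn -[RHS]a_inv // /W setIC; congr a.
  by apply/seteqP; split => x; rewrite /= -iterSr.
pose C := \bigcap_n iter n shift @^-1` P.
have mC : measurable C.
  by apply: bigcap_measurable => // n _; exact: measurable_iter_preimage.
have CP : C `<=` P by move=> x /(_ 0%N Logic.I).
have CC : C `<=` shift @^-1` C.
  by move=> x Cx n _; have := Cx n.+1 Logic.I; rewrite /= -iterSr.
have PDC : P `\` C = \bigcup_n W n.
  apply/seteqP; split => [x [Px nC]|x [n _ [Px nPx]]]; last first.
    by split => // Cx; exact: nPx (Cx n Logic.I).
  apply: contrapT => nW; apply: nC => n _; apply: contrapT => nPx.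
  by apply: nW; exists n.
have aPDC : a (P `\` C) = 0.
  have mS n : measurable (seqDU W n).
    by apply: measurableD => //; exact: bigsetU_measurable.
  rewrite /a PDC seqDU_bigcup_eq !measure_bigcup //.
  apply/eqP; rewrite subr_eq0; apply/eqP; congr fine.
  apply: eq_eseriesr => n _; apply: a_eq => //.
  rewrite -(setIidl (@subset_seqDU _ W n)); apply: a_sub0 => //.
  by move=> x [].
(* a charge of total mass zero and constant sign vanishes *)
suff a_sign : (forall B, measurable B -> 0 <= a B) \/
              (forall B, measurable B -> a B <= 0).
  move=> B mB; apply: a_eq => //.
  have mB' : measurable (~` B) by exact: measurableC.
  have := a_split setT B measurableT mB; rewrite aT setTI setTD.
  by case: a_sign => sg; have := sg B mB; have := sg _ mB'; lra.
have [C0|C1] := tmu C mC CC.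
  right => B mB; rewrite (a_split B P) //.
  have aC : a C = 0 by rewrite /a C0 nu_mu // subrr.
  have aP : a P = 0 by rewrite (a_split P C) // aPDC setIidr // aC addr0.
  rewrite a_sub0 // add0r; apply: a_le0; first exact: measurableD.
  by move=> x [].
left => B mB; rewrite (a_split B C) //.
have mC' : measurable (~` C) by exact: measurableC.
have muC' : mu (~` C) = 0%E by rewrite probability_setC // C1 subee.
have muB : mu (B `\` C) = 0%E.
  by apply: subset_measure0 muC' => //; exact: measurableD.
rewrite [a (B `\` C)]/a muB nu_mu //; last exact: measurableD.
rewrite subrr addr0; apply: a_ge0; first exact: measurableI.
by move=> x [_ /CP].
Qed.

End invariant_uniqueness.

(** * Comparison on cylinders and ergodicity *)

Section sft_measures.
Context (R : realType) (m : nat) (A : 'M[nat]_m) (A0 : SigmaA A !=set0).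
Context (m_ge2 : (1 < m)%N).
Local Notation X := (borel_sft R A0).
Local Notation cyl := (@word_cylinder R m A A0).
Local Notation shift := (@sft_shift R m A A0).
Local Notation mcyl := (@measurable_word_cylinder R m A A0).

Lemma measure_cylinder_rcons (mu : {measure set X -> \bar R}) s :
  mu (cyl s) = (\sum_(j < m) mu (cyl (rcons s j)))%E.
Proof.
rewrite word_cylinder_rcons; apply: measure_bigsetU_ord => [j|]; first exact: mcyl.
apply/trivIsetP => i j _ _ ij; rewrite word_cylinder_disj ?size_rcons //.
by apply: contra ij => /eqP/rcons_inj[->].
Qed.

Lemma measure_cylinder_cons (mu : {measure set X -> \bar R}) s :
  mu (shift @^-1` cyl s) = (\sum_(j < m) mu (cyl (j :: s)))%E.
Proof.
rewrite word_cylinder_shift; apply: measure_bigsetU_ord => [j|]; first exact: mcyl.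
apply/trivIsetP => i j _ _ ij; rewrite word_cylinder_disj //.
by apply: contra ij => /eqP[->].
Qed.

Lemma measure_cylinder_cat (mu : {measure set X -> \bar R}) s k :
  mu (cyl s) = (\sum_(u : k.-tuple 'I_m) mu (cyl (s ++ u)))%E.
Proof.
elim: k s => [|k IHk] s.
  by rewrite (big_tuple0 (fun u => mu (cyl (s ++ u)))) cats0.
rewrite (big_tupleS _ (fun u => mu (cyl (s ++ u)))) measure_cylinder_rcons.
apply: eq_bigr => j _; rewrite IHk; apply: eq_bigr => u _.
by rewrite cat_rcons.
Qed.

(** The differences of the cylinder masses are nonnegative and consistent,
    hence the masses of a third measure [rho] by [cylinder_extension]; then [mu
    + rho] and [nu] agree on cylinders, so everywhere. *)
Theorem cylinder_comparison (mu nu : {measure set X -> \bar R}) :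
  (nu setT < +oo)%E ->
  (forall s, (0 < size s)%N -> (mu (cyl s) <= nu (cyl s))%E) ->
  forall B : set X, measurable B -> (mu B <= nu B)%E.
Proof.
move=> nuT mu_nu'.
have mu_nu s : (mu (cyl s) <= nu (cyl s))%E.
  case: s => [|j s]; last exact: mu_nu'.
  rewrite !(measure_cylinder_rcons _ [::]); apply: lee_sum => j _.
  exact: mu_nu'.
have nufin s : nu (cyl s) \is a fin_num.
  rewrite ge0_fin_numE //; apply: le_lt_trans nuT.
  by apply: le_measure; rewrite ?inE //; exact: mcyl.
have mufin s : mu (cyl s) \is a fin_num.
  by rewrite ge0_fin_numE //; apply: le_lt_trans (mu_nu s) _; rewrite -ge0_fin_numE.
have [||s ns|rho rhoE] := @cylinder_extension R m A A0 m_ge2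
    (fun s => fine (nu (cyl s)) - fine (mu (cyl s))).
- by move=> s; rewrite subr_ge0 fine_le.
- by move=> s; rewrite sumrB !sum_fine // -!measure_cylinder_rcons.
- have -> : cyl s = set0.
    by apply/eqP; apply: contraNT ns => /set0P; exact: word_cylinder_sorted.
  by rewrite !measure0 subrr.
have [sg sgE] := add_measure_exists mu rho.
have sg_nu B : measurable B -> sg B = nu B.
  apply: (@measure_unique _ R X _ (fun=> setT)
    (measurable_cylinder_class R A0 m_ge2) (@cylinder_class_setI R m A A0)) => //.
  - by move=> _; right; exists [::]; rewrite word_cylinder_nil.
  - by apply/seteqP; split => // x _; exists 0%N.
  - move=> B' [->|[s ->]]; first by rewrite !measure0.
    by rewrite sgE rhoE -{1}(fineK (mufin s)) -EFinD addrC subrK fineK.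
  - move=> _; rewrite -word_cylinder_nil sgE rhoE.
    by rewrite lte_add_pinfty ?ltry // -ge0_fin_numE.
move=> B mB; rewrite -sg_nu // sgE leeDl //.
Qed.

(** Independence of distant coordinates, up to a constant and up to a bounded
    number of possible gaps. *)
Definition quasi_bernoulli (mu : set X -> \bar R) (r : nat) (c : R) :=
  forall s t, (0 < size s)%N -> (0 < size t)%N ->
    (c%:E * (mu (cyl s) * mu (cyl t)) <=
      \sum_(1 <= l < r.+1) \sum_(u : l.-tuple 'I_m) mu (cyl (s ++ u ++ t)))%E.

Lemma measure_cylinder_link (mu : {measure set X -> \bar R}) s t l :
  (\sum_(u : l.-tuple 'I_m) mu (cyl (s ++ u ++ t)))%E =
  mu (cyl s `&` iter (size s + l) shift @^-1` cyl t).
Proof.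
have mt : measurable (iter (size s + l) shift @^-1` cyl t : set X).
  apply: measurable_iter_preimage; [exact: measurable_shift|exact: mcyl].
have [rho rhoE] := restr_measure_exists mu mt.
rewrite -rhoE (measure_cylinder_cat rho s l); apply: eq_bigr => u _.
by rewrite rhoE catA word_cylinder_cat size_cat size_tuple.
Qed.

(** Both sides are measures in [B], so cylinders suffice by comparison. *)
Lemma quasi_bernoulli_mixing (mu : probability X R) r c : 0 <= c ->
  quasi_bernoulli mu r c -> forall s, (0 < size s)%N -> forall B : set X,
  measurable B -> (c%:E * (mu (cyl s) * mu B) <=
    \sum_(1 <= l < r.+1) mu (cyl s `&` iter (size s + l) shift @^-1` B))%E.
Proof.
move=> c0 qb s s0 B mB.
have mfin B' : measurable B' -> mu B' \is a fin_num.
  by move=> ?; exact: fin_num_measure.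
have [rho rhoE] := restr_measure_exists mu (mcyl s).
have mshift l : measurable_fun setT (iter l shift : X -> X).
  move=> _ B' mB'; rewrite setTI.
  by apply: measurable_iter_preimage => //; exact: measurable_shift.
have /choice[nu nuE] : forall l, exists nu : {measure set X -> \bar R},
    forall B', nu B' = rho (iter (size s + l) shift @^-1` B').
  by move=> l; exact: push_measure_exists.
have [sg sgE] := sum_measure_exists nu r.
have [mu1 mu1E] := scale_measure_exists mu
  (mulr_ge0 c0 (fine_ge0 (measure_ge0 mu (cyl s)))).
have sgB B' : sg B' =
    (\sum_(1 <= l < r.+1) mu (cyl s `&` iter (size s + l) shift @^-1` B'))%E.
  by rewrite sgE; apply: eq_bigr => l _; rewrite nuE rhoE setIC.
have mu1B B' : mu1 B' = (c%:E * (mu (cyl s) * mu B'))%E.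
  by rewrite mu1E EFinM fineK ?muleA // mfin //; exact: mcyl.
rewrite -mu1B -sgB; apply: cylinder_comparison => // [|t t0].
  rewrite sgB; apply: (@le_lt_trans _ _ (\sum_(1 <= l < r.+1) 1)%E).
    apply: lee_sum => l _; apply: probability_le1.
    apply: measurableI; first exact: mcyl.
    by rewrite -[X in measurable X]setTI; exact: mshift.
  by rewrite sumEFin ltry.
rewrite mu1B sgB; apply: le_trans (qb s t s0 t0) _.
rewrite le_eqVlt; apply/orP; left; apply/eqP; apply: eq_bigr => l _.
exact: measure_cylinder_link.
Qed.

(** For such a [C] the [r] terms of the mixing inequality all equal [mu (cyl s
    `&` C)], whence [c * mu C * mu B <= r * mu (B `&` C)] for cylinders [B],
    and by comparison for all Borel sets. Taking for [B] the complement of [C]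
    makes the right-hand side zero. *)
Theorem quasi_bernoulli_ergodic (mu : probability X R) r c : 0 < c ->
  quasi_bernoulli mu r c -> invariant_measure (shift : X -> X) mu ->
  subinvariant_trivial (shift : X -> X) mu.
Proof.
move=> c0 qb inv C mC CC.
have mshift : measurable_fun setT (shift : X -> X) by exact: measurable_shift.
have mfin B' : measurable B' -> mu B' \is a fin_num.
  by move=> ?; exact: fin_num_measure.
have Cn n : C `<=` iter n shift @^-1` C.
  by elim: n => [//|n IHn] x /IHn /= /CC.
have mCn n : measurable (iter n shift @^-1` C : set X).
  exact: measurable_iter_preimage.
have same (B : set X) n : measurable B ->
    mu (B `&` iter n shift @^-1` C) = mu (B `&` C).
  move=> mB.
  have mI n' : measurable (B `&` iter n' shift @^-1` C : set X).
    exact: measurableI.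
  (* [C] and its preimages have the same finite mass, and are nested *)
  have dif : mu (iter n shift @^-1` C `\` C) = 0%E.
    rewrite measureD //; last by rewrite -ge0_fin_numE // mfin.
    by rewrite setIidr // (invariant_iter mshift) // subee // mfin.
  have dif' : mu ((B `&` iter n shift @^-1` C) `\` C) = 0%E.
    apply: subset_measure0 dif; [exact: measurableD|exact: measurableD|].
    by move=> x [[_ ?] ?].
  have -> : mu (B `&` iter n shift @^-1` C) =
      (mu ((B `&` iter n shift @^-1` C) `\` C) +
       mu ((B `&` iter n shift @^-1` C) `&` C))%E := measureDI mu (mI n) mC.
  by rewrite dif' add0e -setIA (setIidr (Cn n)).
have [mu1 mu1E] : exists mu1 : {measure set X -> \bar R},
    forall B, mu1 B = ((c * fine (mu C))%:E * mu B)%E.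
  by apply: scale_measure_exists; rewrite mulr_ge0 ?(ltW c0) ?fine_ge0.
have [rho rhoE] : exists rho : {measure set X -> \bar R},
    forall B, rho B = mu (B `&` C) by exact: restr_measure_exists.
have [mu2 mu2E] := scale_measure_exists rho (ler0n R r).
have le12 : forall B : set X, measurable B -> (mu1 B <= mu2 B)%E.
  apply: cylinder_comparison.
    rewrite mu2E rhoE setTI -(fineK (mfin _ mC)) -EFinM ltry //.
  move=> s s0; rewrite mu1E mu2E EFinM fineK ?mfin // -muleA [(mu C * _)%E]muleC.
  apply: le_trans (quasi_bernoulli_mixing (ltW c0) qb s0 mC) _.
  rewrite le_eqVlt; apply/orP; left; apply/eqP.
  have mI : measurable (cyl s `&` C : set X) by apply: measurableI => //; exact: mcyl.
  rewrite rhoE -(fineK (mfin _ mI)) (eq_bigr (fun=> (fine (mu (cyl s `&` C)))%:E)).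
    by rewrite sumEFin big_const_nat iter_addr_0 subn1 -(mulr_natl (fine _)) EFinM.
  by move=> l _; rewrite same ?fineK ?mfin //; exact: mcyl.
have mC' : measurable (~` C) by exact: measurableC.
have := le12 _ mC'; rewrite mu1E mu2E rhoE setICl measure0 mule0.
rewrite probability_setC // -(fineK (mfin _ mC)) -EFinB -EFinM lee_fin.
have : 0 <= fine (mu C) <= 1.
  by rewrite fine_ge0 //= -lee_fin fineK ?mfin // probability_le1.
set x := fine (mu C) => /andP[x0 x1] h.
have /eqP : x * (1 - x) = 0.
  apply/le_anti; rewrite mulr_ge0 ?subr_ge0 // andbT.
  by rewrite -(pmulr_rle0 _ c0) mulrA.
rewrite mulf_eq0 subr_eq0 => /orP[/eqP ->|/eqP <-]; by [left|right].
Qed.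

End sft_measures.

(** * Gibbs measures of quasi-multiplicative weights *)

Section gibbs_measures.
Context (R : realType) (m : nat) (A : 'M[nat]_m) (A0 : SigmaA A !=set0).
Context (m_ge2 : (1 < m)%N).
Context (w : seq 'I_m -> R) (r : nat) (c : R).
Context (wqm : quasi_multiplicative w r c).
Context (w_adm : forall s, ~~ sorted (allowed A) s -> w s = 0).
Local Notation X := (borel_sft R A0).
Local Notation cyl := (@word_cylinder R m A A0).
Local Notation shift := (@sft_shift R m A A0 : X -> X).
Local Notation P := (growth_rate w).

Definition gibbs_on_cylinders (mu : set X -> \bar R) : Prop :=
  exists C1 C2 : R, [/\ 0 < C1, 0 < C2 & forall s, (0 < size s)%N ->
    ((C1 * (expR (- ((size s)%:R * P)) * w s))%:E <= mu (cyl s)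
      <= (C2 * (expR (- ((size s)%:R * P)) * w s))%:E)%E].

(** The exponential factors of [s], [u] and [t] multiply to that of [s ++ u ++
    t] up to [exp (l P)], where [l <= r] is the length of the connecting word
    [u]. *)
Lemma gibbs_quasi_bernoulli (mu : probability X R) : gibbs_on_cylinders mu ->
  exists2 c' : R, 0 < c' & quasi_bernoulli mu r c'.
Proof.
move=> [C1 [C2 [C10 C20 gib]]]; have [w_ge0 _ _ c0 w_super] := wqm.
pose g s := fine (mu (cyl s)).
have gE s : mu (cyl s) = (g s)%:E.
  by rewrite /g fineK // fin_num_measure //; exact: measurable_word_cylinder.
have g0 s : 0 <= g s by rewrite fine_ge0.
have gl s : (0 < size s)%N -> C1 * (expR (- ((size s)%:R * P)) * w s) <= g s.
  by move=> /gib; rewrite gE !lee_fin => /andP[].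
have gu s : (0 < size s)%N -> g s <= C2 * (expR (- ((size s)%:R * P)) * w s).
  by move=> /gib; rewrite gE !lee_fin => /andP[].
pose e := expR (r%:R * `|P|); have e0 : 0 < e by exact: expR_gt0.
exists (c * C1 / (C2 ^+ 2 * e)).
  by rewrite divr_gt0 // mulr_gt0 // exprn_gt0.
move=> s t s0 t0; rewrite !gE.
rewrite (eq_bigr (fun l => (\sum_(u : l.-tuple 'I_m) g (s ++ u ++ t))%:E));
    last first.
  by move=> l _; rewrite -sumEFin; apply: eq_bigr => u _; rewrite gE.
rewrite sumEFin -!EFinM lee_fin mulrAC ler_pdivrMr ?mulr_gt0 ?exprn_gt0 //.
set x := expR (- ((size s)%:R * P)) in gu gl *.
pose y := expR (- ((size s)%:R * P)); pose z := expR (- ((size t)%:R * P)).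
have y0 : 0 < y by exact: expR_gt0.
have z0 : 0 < z by exact: expR_gt0.
apply: (@le_trans _ _ (C1 * C2 ^+ 2 * (y * z) * connected_sum w r s t)).
  apply: (@le_trans _ _ (C1 * C2 ^+ 2 * (y * z) * (c * (w s * w t)))); last first.
    by rewrite ler_pM2l ?w_super // !mulr_gt0 // exprn_gt0.
  have -> : C1 * C2 ^+ 2 * (y * z) * (c * (w s * w t)) =
    c * C1 * ((C2 * (y * w s)) * (C2 * (z * w t))) by ring.
  by rewrite ler_pM2l ?mulr_gt0 //; apply: ler_pM => //; exact: gu.
rewrite /connected_sum mulr_sumr mulr_suml !big_nat; apply: ler_sum => l /andP[l1 lr].
rewrite mulr_sumr mulr_suml; apply: ler_sum => u _.
have sut : (0 < size (s ++ u ++ t))%N by rewrite size_cat addn_gt0 s0.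
apply: (@le_trans _ _ (C1 * (expR (- ((size (s ++ u ++ t))%:R * P)) *
    w (s ++ u ++ t)) * (C2 ^+ 2 * e))); last first.
  by rewrite ler_pM2r ?gl // mulr_gt0 // exprn_gt0.
rewrite !size_cat size_tuple !natrD.
have -> : expR (- (((size s)%:R + (l%:R + (size t)%:R)) * P)) =
    y * z * expR (- (l%:R * P)).
  by rewrite /y /z -!expRD; congr expR; ring.
have ee : 1 <= expR (- (l%:R * P)) * e.
  rewrite -expRD -{1}expR0 ler_expR addrC subr_ge0.
  apply: le_trans (ler_norm _) _; rewrite normrM (ger0_norm (ler0n R l)) ler_wpM2r //.
  by rewrite ler_nat; lia.
set v := w _; set h := expR (- (l%:R * P)) in ee *.
have -> : C1 * (y * z * h * v) * (C2 ^+ 2 * e) =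
  C1 * C2 ^+ 2 * (y * z) * v * (h * e) by ring.
by rewrite ler_peMr // !mulr_ge0 ?w_ge0 // ?exprn_ge0 ?ltW.
Qed.

Lemma gibbs_null (mu nu : probability X R) :
  gibbs_on_cylinders mu -> gibbs_on_cylinders nu ->
  forall B, measurable B -> mu B = 0%E -> nu B = 0%E.
Proof.
move=> [C1 [C1' [C10 _ gmu]]] [C2' [C2 [_ C20 gnu]]] B mB muB.
have C0 : 0 <= C2 / C1 by rewrite ltW // divr_gt0.
have [rho rhoE] : exists rho : {measure set X -> \bar R},
    forall B, rho B = ((C2 / C1)%:E * mu B)%E by exact: scale_measure_exists.
apply/le_anti; rewrite measure_ge0 andbT.
have -> : 0%E = rho B by rewrite rhoE muB mule0.
apply: cylinder_comparison => //.
  by rewrite rhoE probability_setT mule1 ltry.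
move=> s s0; have /andP[_ nus] := gnu s s0; have /andP[mus _] := gmu s s0.
apply: le_trans nus _; rewrite rhoE.
apply: le_trans (lee_wpmul2l _ mus); last by rewrite lee_fin.
by rewrite -EFinM lee_fin [leRHS]mulrA divfK // gt_eqF.
Qed.

(** Any invariant measure with the Gibbs bounds is ergodic, so that ergodicity
    has to be checked neither in the construction nor for the competitor. *)
Theorem gibbs_measure_exists_unique : exists_unique_measure
  (fun mu : probability X R =>
    [/\ invariant_measure shift mu, shift_ergodic mu & gibbs_on_cylinders mu]).
Proof.
have [w_ge0 _ _ c0 w_super] := wqm.
have mshift : measurable_fun setT shift by exact: measurable_shift.
have triv (mu : probability X R) : invariant_measure shift mu ->
    gibbs_on_cylinders mu -> subinvariant_trivial shift mu.
  move=> imu /gibbs_quasi_bernoulli[c' c'0 qb].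
  exact: quasi_bernoulli_ergodic qb imu.
have [f [f1 f_rcons f_cons [C1 [C2 [C10 C20 gib]]]]] := invariant_gibbs_weights wqm.
have f_ge0 s : 0 <= f s.
  by have /andP[+ _] := gib s; apply: le_trans; rewrite !mulr_ge0 ?expR_ge0 // ltW.
have f_adm s : ~~ sorted (allowed A) s -> f s = 0.
  move=> ns; apply/le_anti; rewrite f_ge0 andbT.
  by have /andP[_] := gib s; rewrite w_adm // !mulr0.
have [mu0 mu0E] := @cylinder_extension R m A A0 m_ge2 f f_ge0 f_rcons f_adm.
have mu0T : mu0 setT = 1%E by rewrite -word_cylinder_nil mu0E f1.
have [mu mu_mu0] := probability_measure_exists mu0T.
have muE s : mu (cyl s) = (f s)%:E by rewrite mu_mu0 mu0E.
have gmu : gibbs_on_cylinders mu.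
  by exists C1, C2; split => // s _; rewrite muE !lee_fin.
have imu : invariant_measure shift mu.
  have [nu nuE] : exists nu : {measure set X -> \bar R},
    forall B, nu B = mu (shift @^-1` B) by exact: push_measure_exists.
  have muT : (mu setT < +oo)%E by rewrite probability_setT ltry.
  have eq_cyl s : nu (cyl s) = mu (cyl s).
    rewrite nuE muE f_cons -sumEFin; under eq_bigr do rewrite -muE.
    exact: measure_cylinder_cons.
  move=> B mB; rewrite -nuE; apply/le_anti/andP; split.
    apply: cylinder_comparison => //.
    by move=> s _; rewrite eq_cyl.
  apply: cylinder_comparison => //.
    by rewrite nuE preimage_setT.
  by move=> s _; rewrite eq_cyl.
exists mu; split => [|nu [inu _ gnu]].
  by split => // B mB eB; apply: triv => //; rewrite eB.
apply: (invariant_probability_unique mshift) => //; first exact: triv.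
exact: gibbs_null.
Qed.

End gibbs_measures.

(** * Weights of products of nonnegative matrices *)

Lemma finite_pos_lower_bound (R : realFieldType) (T : finType) (F : T -> R) :
  (forall i, 0 < F i) -> exists2 e, 0 < e & forall i, e <= F i.
Proof.
move=> F0; have S0 : 0 < 1 + \sum_i (F i)^-1.
  by rewrite ltr_pwDl // sumr_ge0 // => i _; rewrite invr_ge0 ltW.
exists (1 + \sum_i (F i)^-1)^-1; first by rewrite invr_gt0.
move=> i; rewrite -[leRHS]invrK lef_pV2 ?posrE ?invr_gt0 //.
rewrite (bigD1 i) //= addrCA lerDl addr_ge0 // sumr_ge0 // => j _.
by rewrite invr_ge0 ltW.
Qed.

Section matrix_norm.
Context (R : realType) (d : nat).
Implicit Types B C G : 'M[R]_d.

Lemma sum_normE B : sum_norm B = \sum_i \sum_j B i j.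
Proof.
rewrite /sum_norm -mulmxA !mxE; apply: eq_bigr => i _.
by rewrite !mxE mul1r; apply: eq_bigr => j _; rewrite mxE mulr1.
Qed.

Lemma sum_norm_ge0 B : (forall i j, 0 <= B i j) -> 0 <= sum_norm B.
Proof. by move=> B0; rewrite sum_normE; apply: sumr_ge0 => i _; apply: sumr_ge0. Qed.

Lemma sum_norm1 : sum_norm (1%:M : 'M[R]_d) = d%:R.
Proof.
rewrite sum_normE -[RHS](_ : \sum_(i < d) 1 = _); last first.
  by rewrite sumr_const card_ord.
apply: eq_bigr => i _; rewrite (bigD1 i) //= mxE eqxx big1 ?addr0 // => j ji.
by rewrite mxE eq_sym (negbTE ji).
Qed.

(** The norm of [B *m G *m C] is the bilinear form of [G] evaluated at the
    column sums of [B] and the row sums of [C], whose totals are the norms of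
    [B] and [C]. *)
Lemma sum_normM_sandwich B G C : sum_norm (B *m G *m C) =
  \sum_a \sum_b (\sum_i B i a) * G a b * (\sum_j C b j).
Proof.
rewrite sum_normE.
transitivity (\sum_i \sum_j \sum_b \sum_a B i a * G a b * C b j).
  apply: eq_bigr => i _; apply: eq_bigr => j _; rewrite mxE.
  by apply: eq_bigr => b _; rewrite mxE mulr_suml.
transitivity (\sum_b \sum_a \sum_i \sum_j B i a * G a b * C b j); last first.
  rewrite exchange_big; apply: eq_bigr => a _; apply: eq_bigr => b _.
  rewrite !mulr_suml; apply: eq_bigr => i _.
  by rewrite mulr_sumr.
under eq_bigr => i _ do rewrite exchange_big.
rewrite exchange_big; apply: eq_bigr => b _.
under eq_bigr => i _ do rewrite exchange_big.
by rewrite exchange_big.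
Qed.

Lemma sum_normM B C : (forall i j, 0 <= B i j) -> (forall i j, 0 <= C i j) ->
  sum_norm (B *m C) <= sum_norm B * sum_norm C.
Proof.
move=> B0 C0; rewrite -[B in leLHS]mulmx1 sum_normM_sandwich !sum_normE.
rewrite [X in X * _]exchange_big mulr_suml; apply: ler_sum => a _.
rewrite [leLHS](bigD1 a) //= [X in _ + X <= _]big1 ?addr0; last first.
  by move=> b ba; rewrite mxE eq_sym (negbTE ba) mulr0 mul0r.
rewrite mxE eqxx mulr1.
rewrite ler_wpM2l ?sumr_ge0 // [leRHS](bigD1 a) //= lerDl.
by apply: sumr_ge0 => b _; apply: sumr_ge0.
Qed.

Lemma sum_norm_positive_middle B G C (e : R) :
  (forall i j, 0 <= B i j) -> (forall i j, 0 <= C i j) ->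
  (forall a b, e <= G a b) ->
  e * (sum_norm B * sum_norm C) <= sum_norm (B *m G *m C).
Proof.
move=> B0 C0 eG; rewrite sum_normM_sandwich !sum_normE.
rewrite [X in _ * (X * _)]exchange_big mulr_suml mulr_sumr; apply: ler_sum => a _.
rewrite !mulr_sumr; apply: ler_sum => b _.
by rewrite mulrA ler_wpM2r ?sumr_ge0 // mulrC ler_wpM2l ?sumr_ge0.
Qed.

Lemma sum_norm_sum (I : Type) (s : seq I) (p : pred I) (F : I -> 'M[R]_d) :
  sum_norm (\sum_(i <- s | p i) F i) = \sum_(i <- s | p i) sum_norm (F i).
Proof.
apply: (big_morph (@sum_norm R d)) => [B C|].
  by rewrite /sum_norm mulmxDr mulmxDl mxE.
by rewrite /sum_norm mulmx0 mul0mx mxE.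
Qed.

End matrix_norm.

Section matrix_weights.
Context (R : realType) (m d : nat) (A : 'M[nat]_m) (Mi : 'I_m -> 'M[R]_d) (q : R).
Implicit Types s t : seq 'I_m.

(** Zero weight for inadmissible words lets all sums range over all tuples. *)
Definition matrix_weight s : R :=
  if sorted (allowed A) s then sum_norm (word_mx Mi s) `^ q else 0.
Local Notation w := matrix_weight.

Lemma word_mx_cat s t : word_mx Mi (s ++ t) = word_mx Mi s *m word_mx Mi t.
Proof.
elim: s => [|i s IHs]; first by rewrite /word_mx big_nil mul1mx.
by rewrite /word_mx cat_cons !big_cons -!/(word_mx Mi _) IHs mulmxA.
Qed.

Lemma pressureE : pressure A Mi q = growth_rate w.
Proof.
rewrite /pressure /growth_rate; congr (limn _); apply/funext => n.
congr (_ * ln _); rewrite /partition_sum big_mkcond; apply: eq_bigr => J _.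
by rewrite inE.
Qed.

Context (d_gt0 : (0 < d)%N) (Mi_ge0 : forall i a b, 0 <= Mi i a b).
Context (r : nat) (r_gt0 : (0 < r)%N) (q_gt0 : 0 < q).
Context (H2 : forall (i j : 'I_m) (a b : 'I_d),
  0 < (\sum_(1 <= k < r.+1) \sum_(K in link_words A k i j) word_mx Mi K) a b).

Lemma word_mx_ge0 s a b : 0 <= word_mx Mi s a b.
Proof.
elim: s a b => [|i s IHs] a b; first by rewrite /word_mx big_nil mxE ler0n.
rewrite /word_mx big_cons -/(word_mx Mi s) mxE.
by apply: sumr_ge0 => k _; rewrite mulr_ge0.
Qed.

Let N s := sum_norm (word_mx Mi s).

Let N_ge0 s : 0 <= N s.
Proof. by apply: sum_norm_ge0 => a b; exact: word_mx_ge0. Qed.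

Let N_cat s t : N (s ++ t) <= N s * N t.
Proof. by rewrite /N word_mx_cat; apply: sum_normM => a b; exact: word_mx_ge0. Qed.

Lemma matrix_weight_ge0 s : 0 <= w s.
Proof. by rewrite /matrix_weight; case: ifP => _; rewrite ?powR_ge0. Qed.

Lemma matrix_weight_nil : 0 < w [::].
Proof. by rewrite /matrix_weight /= powR_gt0 // /word_mx big_nil sum_norm1 ltr0n. Qed.

Lemma matrix_weight_cat s t : w (s ++ t) <= w s * w t.
Proof.
rewrite /matrix_weight; case: ifPn => [|_]; last first.
  by rewrite mulr_ge0 ?matrix_weight_ge0.
move=> /cat_sorted2[-> ->]; rewrite -powRM ?N_ge0 //.
by apply: ge0_ler_powR; rewrite ?nnegrE ?mulr_ge0 ?N_ge0 ?(ltW q_gt0) ?N_cat.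
Qed.

(** Otherwise all products of matrices would vanish, against positivity of the
    sums over linking words. *)
Lemma exists_nonzero_letter (i : 'I_m) : exists a, 0 < w [:: a].
Proof.
apply: contrapT => noa.
have N1 a : N [:: a] = 0.
  apply/le_anti; rewrite N_ge0 andbT leNgt; apply/negP => Na.
  by apply: noa; exists a; rewrite /matrix_weight /= powR_gt0.
have := H2 i i (Ordinal d_gt0) (Ordinal d_gt0); rewrite big_nat big1 ?mxE ?ltxx //.
move=> k /andP[k0 _]; apply: big1 => K _; apply/matrixP => a b.
have NK : N K = 0.
  case: K => -[|x K] /= eK; first by rewrite -(eqP eK) in k0.
  by apply/le_anti; rewrite N_ge0 andbT -cat1s (le_trans (N_cat _ _)) // N1 mul0r.
apply/le_anti; rewrite mxE word_mx_ge0 andbT -NK /N sum_normE.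
rewrite (bigD1 a) //= (bigD1 b) //= -addrA lerDl addr_ge0 //.
  by apply: sumr_ge0 => *; exact: word_mx_ge0.
by apply: sumr_ge0 => *; apply: sumr_ge0 => *; exact: word_mx_ge0.
Qed.

Lemma sorted_link s t k (K : k.-tuple 'I_m) x0 : (0 < size s)%N -> (0 < size t)%N ->
  sorted (allowed A) s -> sorted (allowed A) t ->
  K \in link_words A k (last x0 s) (head x0 t) -> sorted (allowed A) (s ++ K ++ t).
Proof.
case/lastP: s => // s i _; case: t => // j t _ ss st.
rewrite last_rcons /= !inE => /andP[_] /=.
rewrite rcons_path => /andP[iK Kj].
case: s ss => [|y s] /=; first by rewrite cat_path iK /= Kj.
by rewrite cat_path last_rcons => ->; rewrite cat_path iK /= Kj.
Qed.

(** Every term is at most [Q `^ q^-1], where [Q] is the sum of the [q]-th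
    powers; this covers [q < 1] and [q >= 1] alike. *)
Lemma power_sum_le (s : seq nat) (F : forall l : nat, l.-tuple 'I_m -> R) :
  (forall l u, 0 <= F l u) ->
  (\sum_(l <- s) \sum_(u : l.-tuple 'I_m) F l u) `^ q <=
  (\sum_(l <- s) \sum_(u : l.-tuple 'I_m) 1) `^ q *
  \sum_(l <- s) \sum_(u : l.-tuple 'I_m) F l u `^ q.
Proof.
move=> F0; set Q := \sum_(l <- s) \sum_(u : l.-tuple 'I_m) F l u `^ q.
have Q0 : 0 <= Q by apply: sumr_ge0 => l _; apply: sumr_ge0 => u _; exact: powR_ge0.
have FQ l u : l \in s -> F l u <= Q `^ q^-1.
  move=> ls; rewrite -[leLHS]powRr1 // -(divff (lt0r_neq0 q_gt0)) powRrM.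
  apply: ge0_ler_powR; rewrite ?nnegrE ?powR_ge0 ?invr_ge0 ?(ltW q_gt0) //.
  rewrite /Q (big_rem l) //= (bigD1 u) //= -addrA lerDl addr_ge0 //.
    by apply: sumr_ge0 => *; exact: powR_ge0.
  by apply: sumr_ge0 => *; apply: sumr_ge0 => *; exact: powR_ge0.
have -> : Q = (Q `^ q^-1) `^ q by rewrite -powRrM mulVf ?powRr1 // gt_eqF.
have n0 : 0 <= \sum_(l <- s) \sum_(u : l.-tuple 'I_m) (1 : R).
  by apply: sumr_ge0 => l _; apply: sumr_ge0.
rewrite -powRM ?powR_ge0 //; apply: ge0_ler_powR; rewrite ?nnegrE ?(ltW q_gt0) //.
- by apply: sumr_ge0 => l _; apply: sumr_ge0.
- by rewrite mulr_ge0 ?powR_ge0.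
rewrite mulr_suml big_seq [leRHS]big_seq; apply: ler_sum => l ls.
by rewrite mulr_suml; apply: ler_sum => u _; rewrite mul1r FQ.
Qed.

(** With [e] a lower bound for the entries of all sums over linking words, [e
    ||M_s|| ||M_t||] is at most the sum of the norms [||M_(s u t)||] over the
    words [u] that link [s] to [t]; raising to the power [q] costs [n `^ q],
    where [n] is the number of words [u] of length between [1] and [r]. *)
Theorem matrix_weight_quasi_multiplicative (x0 : 'I_m) :
  exists c, quasi_multiplicative w r c.
Proof.
have [e e0 eH2] := @finite_pos_lower_bound R ('I_m * 'I_m * ('I_d * 'I_d))%type
  _ (fun p => H2 p.1.1 p.1.2 p.2.1 p.2.2).
pose n : R := \sum_(1 <= l < r.+1) \sum_(u : l.-tuple 'I_m) 1.
have n0 : 0 < n.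
  rewrite /n big_ltn // ltr_pwDl //; last by apply: sumr_ge0 => l _; apply: sumr_ge0.
  rewrite (bigD1 [tuple x0]) //= ltr_pwDl //; exact: sumr_ge0.
have c0 : 0 < e `^ q / n `^ q by rewrite divr_gt0 // powR_gt0.
apply: (quasi_multiplicative_nonempty matrix_weight_ge0 matrix_weight_nil
  matrix_weight_cat c0 (exists_nonzero_letter x0)) => s t s0 t0.
have conn_ge0 : 0 <= connected_sum w r s t.
  by apply: sumr_ge0 => l _; apply: sumr_ge0 => u _; exact: matrix_weight_ge0.
rewrite {1 2}/matrix_weight; case: ifPn => [ss|_]; last by rewrite mul0r mulr0.
case: ifPn => [st|_]; last by rewrite !mulr0.
pose i := last x0 s; pose j := head x0 t.
pose F l (u : l.-tuple 'I_m) :=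
  if u \in link_words A l i j then N (s ++ u ++ t) else 0.
have F0 l u : 0 <= F l u by rewrite /F; case: ifP.
have le1 : e * (N s * N t) <= \sum_(1 <= l < r.+1) \sum_(u : l.-tuple 'I_m) F l u.
  pose G := \sum_(1 <= l < r.+1) \sum_(K in link_words A l i j) word_mx Mi K.
  have eG a b : e <= G a b by exact: (eH2 (i, j, (a, b))).
  apply: le_trans (sum_norm_positive_middle (word_mx_ge0 s) (word_mx_ge0 t) eG) _.
  rewrite mulmx_sumr mulmx_suml sum_norm_sum.
  rewrite le_eqVlt; apply/orP; left; apply/eqP; apply: eq_bigr => l _.
  rewrite mulmx_sumr mulmx_suml sum_norm_sum /F -big_mkcond.
  by apply: eq_bigr => u _; rewrite /N !word_mx_cat mulmxA.
have le2 : \sum_(1 <= l < r.+1) \sum_(u : l.-tuple 'I_m) F l u `^ q <=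
    connected_sum w r s t.
  apply: ler_sum => l _; apply: ler_sum => u _; rewrite /F.
  case: ifPn => [iuj|_].
    by rewrite /matrix_weight (sorted_link s0 t0 ss st iuj).
  by rewrite powR0 ?matrix_weight_ge0 // gt_eqF.
rewrite -powRM ?N_ge0 // mulrAC ler_pdivrMr ?powR_gt0 //.
rewrite -powRM ?mulr_ge0 ?N_ge0 ?(ltW e0) //.
apply: (@le_trans _ _ ((\sum_(1 <= l < r.+1) \sum_(u : l.-tuple 'I_m) F l u) `^ q)).
  apply: ge0_ler_powR; rewrite ?nnegrE ?(ltW q_gt0) ?mulr_ge0 ?N_ge0 ?(ltW e0) //.
  by apply: sumr_ge0 => l _; apply: sumr_ge0.
apply: le_trans (power_sum_le _ F0) _.
by rewrite mulrC ler_pM2r ?powR_gt0.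
Qed.

End matrix_weights.

(** * The matrix-valued function on the subshift *)

(** A power of [A] without zero rows forces [A] itself to have none, so that
    every letter starts an infinite admissible sequence. *)
Lemma sft_starting_at (R : realType) (m : nat) (A : 'M[nat]_m)
    (A0 : SigmaA A !=set0) (i : 'I_m) : zero_one_mx A -> primitive_mx A ->
  exists x : sft R A0, sft_seq x 0 = i.
Proof.
move=> A01 [[//|p] _ Ap].
have /choice[f Hf] k : exists j, allowed A k j.
  apply: contrapT => /forallNP noj.
  have := Ap k k; rewrite exprS mxE big1 // => j _.
  case: (A01 k j) => [->|Akj]; first by rewrite mul0r.
  by case: (noj j); rewrite /allowed Akj.
have iA : (fun k => iter k f i) \in SigmaA A.
  by rewrite inE => k /=; exact: Hf.
by exists (SigSub iA : sft R A0).
Qed.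

Theorem theorem3p2 (R : realType) (m : nat) (m_ge2 : (1 < m)%N)
    (A : 'M[nat]_m) (A01 : zero_one_mx A) (A_prim : primitive_mx A)
    (d : nat) (d_gt0 : (0 < d)%N)
    (M : sft R (SigmaA_neq0 m_ge2 A01 A_prim) -> 'M[R]_d)
    (M_ge0 : forall x a b, 0 <= M x a b)
    (Mi : 'I_m -> 'M[R]_d)
    (H1 : forall (i : 'I_m) x, cylinder [tuple i] x -> M x = Mi i)
    (r : nat) (r_gt0 : (0 < r)%N)
    (H2 : forall (i j : 'I_m) (a b : 'I_d),
      0 < (\sum_(1 <= k < r.+1) \sum_(K in link_words A k i j) word_mx Mi K)
            a b)
    (q : R) (q_gt0 : 0 < q) :
  exists_unique_measure
    (fun mu : probability (borel_sft R (SigmaA_neq0 m_ge2 A01 A_prim)) R =>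
      [/\ shift_invariant mu, shift_ergodic mu & gibbs_bounds Mi q mu]).
Proof.
set A0 := SigmaA_neq0 m_ge2 A01 A_prim in M M_ge0 H1 *.
(* every letter starts some sequence, so [Mi i] is a value of [M] *)
have Mi_ge0 i a b : 0 <= Mi i a b.
  have [x xi] := sft_starting_at R A0 i A01 A_prim.
  by rewrite -(H1 i x) // => k; rewrite (ord1 k) tnth0.
have [c wqm] := matrix_weight_quasi_multiplicative d_gt0 Mi_ge0 r_gt0 q_gt0 H2
  (Ordinal (ltnW m_ge2)).
have gibbsE (mu : probability (borel_sft R A0) R) :
    gibbs_on_cylinders (matrix_weight A Mi q) mu <-> gibbs_bounds Mi q mu.
  split=> -[C1 [C2 [C10 C20 gib]]]; exists C1, C2; split => //.
    move=> n J n0 Jadm; have := gib J; rewrite size_tuple -cylinderE => /(_ n0).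
    by move: Jadm; rewrite inE /matrix_weight -(pressureE A Mi q) => ->.
  move=> s s0; rewrite /matrix_weight; case: ifPn => [ss|ns].
    have := gib _ (in_tuple s) s0; rewrite inE => /(_ ss) /=.
    by rewrite cylinderE (pressureE A Mi q).
  have -> : word_cylinder s = set0 :> set (sft R A0).
    by apply/eqP; apply: contraNT ns => /set0P; exact: word_cylinder_sorted.
  by rewrite measure0 !mulr0 lexx.
have w_adm s : ~~ sorted (allowed A) s -> matrix_weight A Mi q s = 0.
  by rewrite /matrix_weight => /negbTE ->.
have [mu [[imu emu gmu] umu]] := gibbs_measure_exists_unique A0 m_ge2 wqm w_adm.
exists mu; split; first by split => //; exact/gibbsE.
by move=> nu [inu enu gnu]; apply: umu; split => //; exact/gibbsE.
Qed.
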